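(* As formal power series in $q$, \begin{align*} \sum_{n=0}^{\infty} S(8n)q^n & = \frac{f_2^2f_4^2f_{6}^{16}}{f_1^4f_3^{11}f_{12}^6}+4q^2\frac{f_2^8f_{12}^6}{f_1^6f_3^5f_4^2f_6^2},\\ \sum_{n=0}^{\infty} S(8n+1)q^n & = \frac{f_2f_4^5f_{6}^{13}}{f_1^4f_3^{10}f_8^2f_{12}^4}+8q^2\frac{f_2^3f_6f_8^2f_{12}^4}{f_1^4f_3^6f_4},\\ \sum_{n=0}^{\infty} S(8n+2)q^n & = \frac{f_2^{15}f_{6}^{3}}{f_1^9f_3^{6}f_4^4}-4q\frac{f_4^4f_6^7}{f_1^3f_2f_3^8},\\ \sum_{n=0}^{\infty} S(8n+3)q^n & = \frac{f_2^{11}f_6^3f_{12}^{5}}{f_1^7f_3^7f_4^4f_{24}^2}+8q^2\frac{f_4^4f_6^5f_{24}^2}{f_1^3f_2f_3^7f_{12}},\\ \sum_{n=0}^{\infty} S(8n+4)q^n & = \frac{f_2^8f_{6}^{10}}{f_1^6f_3^{9}f_4^2f_{12}^2}+4q\frac{f_2^2f_4^2f_6^4f_{12}^2}{f_1^4f_3^7},\\ \sum_{n=0}^{\infty} S(8n+5)q^n & = 2\frac{f_2^3f_6^{13}f_{8}^2}{f_1^4f_3^{10}f_4f_{12}^4}+4q\frac{f_2f_4^5f_6f_{12}^4}{f_1^4f_3^6f_8^2},\\ \sum_{n=0}^{\infty} S(8n+6)q^n & = 4\frac{f_2^3f_4^4f_{6}^{3}}{f_1^5f_3^{6}}-\frac{f_2^{11}f_6^7}{f_1^7f_3^8f_4^4},\\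 \sum_{n=0}^{\infty} S(8n+7)q^n & = 4\frac{f_4^4f_6^3f_{12}^{5}}{f_1^3f_2f_3^{7}f_{24}^2}+2q\frac{f_2^{11}f_6^5f_{24}^2}{f_1^7f_3^7f_4^4f_{12}}. \end{align*}
   Context: Let $(a;q)_\infty:=\prod_{k\geq 0}(1-aq^k)$ and, for a positive integer $r$, $f_r:=(q^r;q^r)_\infty=\prod_{k\geq1}(1-q^{rk})$. The function $S(n)$ (the number of overpartitions of $n$ of Schur-type, in the sense of Broudy and Lovejoy) is defined by the generating function $$\sum_{n=0}^{\infty} S(n)q^n = \frac{1}{(q;q^6)_\infty(q^5;q^6)_\infty(q^6;q^6)_\infty}.$$ *)

(* Defs.v *)
From HB Require Import structures.
From mathcomp Require Import all_boot all_order all_algebra.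
From mathcomp Require Import boolp.

Set Implicit Arguments.
Unset Strict Implicit.
Unset Printing Implicit Defensive.

Import GRing.Theory.
Local Open Scope ring_scope.

(* Formal power series \sum_n (coefps a n) q^n. The record is a wrapper that    *)
(* keeps the Cauchy product from clashing with the pointwise ring structure     *)
(* on functions.                                                                *)
Record fps (R : Type) := FPS { coefps : nat -> R }.

Lemma fpsP (R : Type) (a b : fps R) : (forall n, coefps a n = coefps b n) <-> a = b.
Proof.
split=> [|-> //]; case: a b => [f] [g] /= fg.
by congr FPS; apply: funext.
Qed.

HB.instance Definition _ (R : Type) := gen_eqMixin (fps R).
HB.instance Definition _ (R : Type) := gen_choiceMixin (fps R).

Definition zerops (R : nmodType) : fps R := FPS (fun=> 0).
Definition addps (R : nmodType) (a b : fps R) : fps R :=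
  FPS (fun n => coefps a n + coefps b n).
Definition oppps (R : zmodType) (a : fps R) : fps R :=
  FPS (fun n => - coefps a n).

Fact addpsA (R : zmodType) : associative (@addps R).
Proof. by move=> a b c; apply/fpsP => n /=; rewrite addrA. Qed.
Fact addpsC (R : zmodType) : commutative (@addps R).
Proof. by move=> a b; apply/fpsP => n /=; rewrite addrC. Qed.
Fact add0ps (R : zmodType) : left_id (zerops R) (@addps R).
Proof. by move=> a; apply/fpsP => n /=; rewrite add0r. Qed.
Fact addNps (R : zmodType) : left_inverse (zerops R) (@oppps R) (@addps R).
Proof. by move=> a; apply/fpsP => n /=; rewrite addNr. Qed.

HB.instance Definition _ (R : zmodType) :=
  GRing.isZmodule.Build (fps R)
    (@addpsA R) (@addpsC R) (@add0ps R) (@addNps R).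

Definition oneps (R : comNzRingType) : fps R := FPS (fun n => (n == 0)%:R).
Definition mulps (R : comNzRingType) (a b : fps R) : fps R :=
  FPS (fun n => \sum_(i < n.+1) coefps a i * coefps b (n - i)).

Definition truncps (R : comNzRingType) (N : nat) (a : fps R) : {poly R} :=
  \poly_(i < N) coefps a i.

Lemma coef_truncM (R : comNzRingType) (a b : fps R) (n N : nat) :
  (n < N)%N -> (truncps N a * truncps N b)`_n = coefps (mulps a b) n.
Proof.
move=> nN; rewrite coefM; apply: eq_bigr => i _.
rewrite !coef_poly (leq_ltn_trans (leq_subr _ _) nN).
by rewrite (leq_ltn_trans _ nN) // -ltnS.
Qed.

Fact mulpsC (R : comNzRingType) : commutative (@mulps R).
Proof.
move=> a b; apply/fpsP => n.
by rewrite -!(coef_truncM _ _ (ltnSn n)) mulrC.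
Qed.
Fact mulpsA (R : comNzRingType) : associative (@mulps R).
Proof.
move=> a b c; apply/fpsP => n.
transitivity ((truncps n.+1 a * truncps n.+1 b * truncps n.+1 c)`_n).
  rewrite -mulrA coefM /=; apply: eq_bigr => i _.
  by rewrite coef_truncM ?ltnS ?leq_subr // coef_poly ltn_ord.
rewrite coefM /=; apply: eq_bigr => i _.
by rewrite coef_truncM // coef_poly ltnS leq_subr.
Qed.
Fact mul1ps (R : comNzRingType) : left_id (oneps R) (@mulps R).
Proof.
move=> a; apply/fpsP => n /=.
rewrite big_ord_recl /= mul1r subn0 big1 ?addr0 // => i _.
by rewrite mul0r.
Qed.
Fact mulpsDl (R : comNzRingType) : left_distributive (@mulps R) (@addps R).
Proof.
move=> a b c; apply/fpsP => n /=.
by rewrite -big_split; apply: eq_bigr => i _; rewrite mulrDl.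
Qed.
Fact oneps_neq0 (R : comNzRingType) : oneps R != zerops R.
Proof. by apply/eqP => /fpsP /(_ 0) /= /eqP; rewrite oner_eq0. Qed.

HB.instance Definition _ (R : comNzRingType) :=
  GRing.Zmodule_isComNzRing.Build (fps R)
    (@mulpsA R) (@mulpsC R) (@mul1ps R) (@mulpsDl R) (oneps_neq0 R).

(* The coefficients b_n, ..., b_0 of 1/a, in this order, from                   *)
(* a_0 b_(n+1) = - \sum_(i <= n) a_(i+1) b_(n-i).                               *)
Fixpoint invps_seq (R : comUnitRingType) (a : fps R) (n : nat) : seq R :=
  if n is m.+1 then
    let s := invps_seq a m in
    - (coefps a 0)^-1 * (\sum_(i < m.+1) coefps a i.+1 * s`_i) :: s
  else [:: (coefps a 0)^-1].

Definition unitps (R : comUnitRingType) : pred (fps R) :=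
  fun a => coefps a 0 \is a GRing.unit.
Definition invps (R : comUnitRingType) (a : fps R) : fps R :=
  if unitps a then FPS (fun n => (invps_seq a n)`_0) else a.

Lemma nth_invps_seq (R : comUnitRingType) (a : fps R) (n i : nat) :
  (i <= n)%N -> (invps_seq a n)`_i = (invps_seq a (n - i))`_0.
Proof.
elim: n i => [|n IHn] [|i] //; rewrite ltnS => /IHn /= ->.
by rewrite subSS.
Qed.

Fact mulVps (R : comUnitRingType) :
  {in @unitps R, left_inverse 1 (@invps R) *%R}.
Proof.
move=> a ua; rewrite mulrC; have {}ua : unitps a := ua.
apply/fpsP => n; rewrite /invps ua /= big_ord_recl subn0 /=.
case: n => [|n]; first by rewrite big_ord0 addr0 /= divrr.
rewrite /= mulrA mulrN divrr // mulN1r; apply/eqP.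
rewrite addrC subr_eq0; apply/eqP; apply: eq_bigr => i _.
by rewrite (nth_invps_seq _ (ltn_ord i : (i <= n)%N)) /bump subSS.
Qed.
Fact unitpsP (R : comUnitRingType) (a b : fps R) : b * a = 1 -> unitps a.
Proof.
move=> /fpsP /(_ 0%N) /=; rewrite big_ord1 /= subn0 => ba.
by apply/unitrPr; exists (coefps b 0); rewrite mulrC.
Qed.
Fact invps_out (R : comUnitRingType) : {in [predC @unitps R], @invps R =1 id}.
Proof. by move=> a ua; rewrite /invps (negbTE ua : unitps a = false). Qed.

HB.instance Definition _ (R : comUnitRingType) :=
  GRing.ComNzRing_hasMulInverse.Build (fps R)
    (@mulVps R) (@unitpsP R) (@invps_out R).

Definition qvar : fps int := FPS (fun n => (n == 1)%:R).
Notation "''q'" := qvar (at level 0) : ring_scope.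

(* (a; x)_oo = \prod_(k >= 0) (1 - a x^k) for a power series x without constant *)
(* term: then a x^k has order at least k, so the coefficient of q^n in the      *)
(* partial products is constant from k <= n on (qpochE).                        *)
Definition qpoch (a x : fps int) : fps int :=
  FPS (fun n => coefps (\prod_(k < n.+1) (1 - a * x ^+ k)) n).

Lemma coefps_order (x : fps int) (k n : nat) :
  coefps x 0 = 0 -> (n < k)%N -> coefps (x ^+ k) n = 0.
Proof.
move=> x0; elim: k n => // k IHk n nk; rewrite exprS /=.
apply: big1 => -[[|i] /= lti] _; first by rewrite x0 mul0r.
by rewrite IHk ?mulr0 //; case: n nk lti => // n nk _;
rewrite subSS (leq_ltn_trans (leq_subr _ _)).
Qed.

Lemma qpochE (a x : fps int) (n N : nat) : coefps x 0 = 0 -> (n < N)%N ->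
  coefps (\prod_(k < N) (1 - a * x ^+ k)) n = coefps (qpoch a x) n.
Proof.
move=> x0; elim: N => // N IHN; rewrite ltnS leq_eqVlt => /predU1P[-> //|nN].
rewrite -IHN // big_ord_recr.
set p := (X in coefps X n = _); set p' := \prod_(_ < _) _.
have -> : p = p' - p' * a * x ^+ N by rewrite -mulrA -[X in X - _]mulr1 -mulrBr.
suff p0 : coefps (p' * a * x ^+ N) n = 0.
  by rewrite [LHS](_ : _ = coefps p' n - coefps (p' * a * x ^+ N) n) // p0 subr0.
rewrite [LHS]/=; apply: big1 => i _.
by rewrite coefps_order ?mulr0 // (leq_ltn_trans (leq_subr _ _)).
Qed.

Definition f_ (r : nat) : fps int := qpoch ('q ^+ r) ('q ^+ r).

(* Generating function of the overpartitions of Schur type. *)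
Definition Sover_gf : fps int :=
  1 / (qpoch 'q ('q ^+ 6) * qpoch ('q ^+ 5) ('q ^+ 6)
       * qpoch ('q ^+ 6) ('q ^+ 6)).

Definition Sover (n : nat) : int := coefps Sover_gf n.

(* The quotients in Sover_gf and in the theorem are genuine ones (the ring inverse  *)
(* of a non-unit would be the element itself).                                  *)
Lemma qpoch_unit (r s : nat) : (0 < r)%N ->
  qpoch ('q ^+ r) ('q ^+ s) \is a GRing.unit.
Proof.
move=> r0; suff h : coefps (qpoch ('q ^+ r) ('q ^+ s)) 0 = 1.
  by rewrite qualifE; change (unitps (qpoch ('q ^+ r) ('q ^+ s))); rewrite /unitps h unitr1.
rewrite [LHS](_ : _ = coefps (\prod_(k < 1) (1 - 'q ^+ r * ('q ^+ s) ^+ k)) 0) //.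
rewrite big_ord1 expr0 mulr1.
rewrite [LHS](_ : _ = 1 - coefps ('q ^+ r) 0) //.
by rewrite coefps_order // subr0.
Qed.

Lemma f_unit (r : nat) : (0 < r)%N -> f_ r \is a GRing.unit.
Proof. exact: qpoch_unit. Qed.

(* Main.v *)
Require Import Defs.
From HB Require Import structures.
From mathcomp Require Import all_boot all_order all_algebra.
From mathcomp Require Import boolp classical_sets fsbigop.
From mathcomp Require Import zify ring.

Set Implicit Arguments.
Unset Strict Implicit.
Unset Printing Implicit Defensive.

Import Order.TTheory GRing.Theory Num.Theory.
Local Open Scope ring_scope.

(* The generating function is f_2 f_3 / (f_1 f_6^2); it is split three times    *)
(* into its even and odd parts. With f(a, b) = \sum_(n in Z) a^(n(n+1)/2)       *)
(* b^(n(n-1)/2), phi(q) = f(q, q) and psi(q) = f(q, q^3), the 2-dissections     *)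
(* come from the Jacobi triple product as follows:                              *)
(* - f_3 / f_1 from f(q, q^5) = f(q^8, q^16) + q f(q^4, q^20);                  *)
(* - f_1 f_3 from f(q, q^5) f(-q, -q^5), which is a series in q^2, and          *)
(*   1 / (f_1 f_3) from it by q -> - q;                                         *)
(* - 1 / f_1^2 from phi(q) = phi(q^4) + 2 q psi(q^8);                           *)
(* - 1 / f_1^4 from phi(q) phi(-q) = phi(-q^2)^2 and q -> - q;                  *)
(* - f_1 / f_3^3 from phi(-q^3) f(q, q^5) = f(-q^4, -q^8)^2 + q f(-q^2, -q^10)^2 *)
(*   and q -> - q.                                                              *)

(** Why three splittings suffice: in a quotient of products f_r every factor with even r is a series
    in q^2, so only the powers of f_1 and f_3 need to be dissected. Halving the exponents then gives
    sums of quotients of the same kind. Starting from f_2 f_3 / (f_1 f_6^2) ([Sover_gfE]), the first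
    round meets f_3 / f_1, the second 1 / (f_1 f_3) in both halves, and the third 1 / (f_1 f_3^5), 1
    / (f_1^2 f_3^4), 1 / (f_1^3 f_3^3) and 1 / (f_1^4 f_3^2), each a product of two factors with
    known dissections.

    The dissections rest on two kinds of facts. Splitting the summation set of a theta series or of
    a product of two gives [theta_dissection] and [theta_product]. The [jacobi_triple_product],
    obtained as the limit of the finite identity [jtp_finite], turns every theta series involved
    into a quotient of the f_r. The morphisms q -> - q ([negps]) and q -> q^k ([subps]) carry one
    dissection to another, and the rest is algebra with the f_r and their inverses. *)

Lemma coefpsD (R : zmodType) (a b : fps R) n :
  coefps (a + b) n = coefps a n + coefps b n.
Proof. by []. Qed.

Lemma coefpsN (R : zmodType) (a : fps R) n : coefps (- a) n = - coefps a n.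
Proof. by []. Qed.

Lemma coefps1 (R : comNzRingType) n : coefps (1 : fps R) n = (n == 0)%:R.
Proof. by []. Qed.

Lemma coefpsM (R : comNzRingType) (a b : fps R) n :
  coefps (a * b) n = \sum_(i < n.+1) coefps a i * coefps b (n - i).
Proof. by []. Qed.

Lemma coefps_sum (R : zmodType) I (r : seq I) (P : pred I) (F : I -> fps R) n :
  coefps (\sum_(i <- r | P i) F i) n = \sum_(i <- r | P i) coefps (F i) n.
Proof. by apply: (big_morph (fun a : fps R => coefps a n)). Qed.

Lemma coefpsqM (a : fps int) n :
  coefps ('q * a) n = if n is m.+1 then coefps a m else 0.
Proof.
rewrite coefpsM; case: n => [|n]; first by rewrite big_ord1 mul0r.
rewrite !big_ord_recl /= mul0r add0r mul1r subn1 big1 ?addr0 // => i _.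
by rewrite mul0r.
Qed.

Lemma coefpsqXM k (a : fps int) n :
  coefps ('q ^+ k * a) n = if (k <= n)%N then coefps a (n - k) else 0.
Proof.
elim: k n => [|k IHk] n; first by rewrite mul1r subn0.
by rewrite exprS -mulrA coefpsqM; case: n => // n; rewrite IHk.
Qed.

Lemma coefpsqX k n : coefps ('q ^+ k) n = (n == k)%:R.
Proof.
rewrite -['q ^+ k]mulr1 coefpsqXM coefps1 subn_eq0.
by case: ltngtP.
Qed.

(** Congruence modulo q^N: infinite products are handled through partial products that agree with
    them to this order. *)
Definition eqps (R : Type) (N : nat) (a b : fps R) :=
  forall n, (n < N)%N -> coefps a n = coefps b n.

Lemma eqpsM (R : comNzRingType) N (a b c d : fps R) :
  eqps N a b -> eqps N c d -> eqps N (a * c) (b * d).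
Proof.
move=> ab cd n nN; rewrite !coefpsM; apply: eq_bigr => i _.
by rewrite ab ?cd // ?(leq_ltn_trans (leq_subr _ _)) // (leq_trans (ltn_ord i)).
Qed.

Lemma eqps_prod (R : comNzRingType) N I (r : seq I) (F G : I -> fps R) :
  (forall i, eqps N (F i) (G i)) ->
  eqps N (\prod_(i <- r) F i) (\prod_(i <- r) G i).
Proof.
move=> FG; elim: r => [|i r IHr]; first by rewrite !big_nil.
by rewrite !big_cons; apply: eqpsM.
Qed.

Lemma eqps_sub N M (R : Type) (a b : fps R) :
  (M <= N)%N -> eqps N a b -> eqps M a b.
Proof. by move=> MN ab n nM; apply: ab; apply: leq_trans MN. Qed.

Lemma eqpsP (R : Type) (a b : fps R) : (forall N, eqps N a b) -> a = b.
Proof. by move=> ab; apply/fpsP => n; apply: (ab n.+1). Qed.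

Lemma eqps_qpoch (a x : fps int) N :
  coefps x 0 = 0 -> eqps N (qpoch a x) (\prod_(k < N) (1 - a * x ^+ k)).
Proof. by move=> x0 n nN; rewrite qpochE. Qed.

(** * Substitutions *)

(* The junk case [k = 0] gives the constant term, so [subps k] is a ring        *)
(* morphism for every [k].                                                      *)
Definition subps (k : nat) (a : fps int) : fps int :=
  FPS (fun n => if (k %| n)%N then coefps a (n %/ k) else 0).

Definition negps (a : fps int) : fps int :=
  FPS (fun n => (-1) ^+ n * coefps a n).

Lemma coef_subpsE k (a : fps int) n :
  coefps (subps k a) n = if (k %| n)%N then coefps a (n %/ k) else 0.
Proof. by []. Qed.

Lemma coef_subps k (a : fps int) n :
  (0 < k)%N -> coefps (subps k a) (k * n) = coefps a n.
Proof. by move=> k0; rewrite /= dvdn_mulr // mulKn. Qed.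

Fact subps_is_zmod_morphism k : zmod_morphism (subps k).
Proof. by move=> a b; apply/fpsP => n /=; case: ifP; rewrite ?subr0. Qed.

Fact subps_is_monoid_morphism k : GRing.monoid_morphism (subps k).
Proof.
split=> [|a b]; apply/fpsP => n.
  rewrite coef_subpsE !coefps1; case: ifP => [/dvdnP[m ->]|]; last first.
    by case: n => //; rewrite dvdn0.
  case: k => [|k]; first by rewrite muln0.
  by rewrite mulnK // muln_eq0 orbF.
rewrite coefpsM.
have [/dvdnP[m ->]|kn] := boolP (k %| n)%N; last first.
  rewrite /= (negbTE kn) big1 // => i _.
  case: ifP => ki; last by rewrite mul0r.
  case: ifP => kni; last by rewrite mulr0.
  by case/negP: kn; rewrite -(subnK (ltn_ord i : (i <= n)%N)) dvdn_add.
rewrite mulnC; case: (posnP k) => [->|k0].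
  by rewrite mul0n big_ord1 !coef_subpsE dvdn0 div0n coefpsM big_ord1.
rewrite coef_subps // coefpsM.
rewrite [RHS](bigID (fun i : 'I_ _ => (k %| i)%N)) /= [X in _ + X]big1 ?addr0; last first.
  by move=> i ki; rewrite (negbTE ki) mul0r.
rewrite (reindex_onto (fun j : 'I_m.+1 => inord (k * j) : 'I_(k * m).+1)
  (fun i : 'I_(k * m).+1 => inord (i %/ k) : 'I_m.+1)) /=; last first.
  move=> i /dvdnP[j ij]; apply: val_inj => /=.
  have jm : (j <= m)%N.
    by rewrite -(leq_pmul2l k0) [X in (X <= _)%N]mulnC -ij -ltnS.
  by rewrite {1}ij mulnK // (inordK (_ : (j < m.+1)%N)) // [(k * j)%N]mulnC -ij inordK.
have jk (j : 'I_m.+1) : (k * j < (k * m).+1)%N.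
  by rewrite ltnS leq_pmul2l // -ltnS.
apply: eq_big => [j|j _]; rewrite inordK //.
  by rewrite dvdn_mulr // mulKn // inord_val eqxx.
by rewrite dvdn_mulr // mulKn // -mulnBr dvdn_mulr // mulKn.
Qed.

HB.instance Definition _ k :=
  GRing.isZmodMorphism.Build (fps int) (fps int) (subps k) (subps_is_zmod_morphism k).
HB.instance Definition _ k :=
  GRing.isMonoidMorphism.Build (fps int) (fps int) (subps k) (subps_is_monoid_morphism k).

Lemma subps_inj k : (0 < k)%N -> injective (subps k).
Proof.
by move=> k0 a b ab; apply/fpsP => n; rewrite -(coef_subps _ _ k0) ab coef_subps.
Qed.

Lemma subpsq k : (0 < k)%N -> subps k 'q = 'q ^+ k.
Proof.
move=> k0; apply/fpsP => n; rewrite coefpsqX /=; case: ifP => [/dvdnP[m ->]|].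
  by rewrite mulnK // -{2}[k]mul1n eqn_pmul2r.
by case: eqP => // ->; rewrite dvdnn.
Qed.

Lemma coef_negps (a : fps int) n : coefps (negps a) n = (-1) ^+ n * coefps a n.
Proof. by []. Qed.

Fact negps_is_zmod_morphism : zmod_morphism negps.
Proof. by move=> a b; apply/fpsP => n /=; rewrite mulrBr. Qed.

Fact negps_is_monoid_morphism : GRing.monoid_morphism negps.
Proof.
split=> [|a b]; apply/fpsP.
  by move=> [|n]; rewrite /= ?mulr1 ?mulr0.
move=> n /=; rewrite mulr_sumr; apply: eq_bigr => i _.
by rewrite mulrACA -exprD subnKC // -ltnS.
Qed.

HB.instance Definition _ :=
  GRing.isZmodMorphism.Build (fps int) (fps int) negps negps_is_zmod_morphism.
HB.instance Definition _ :=
  GRing.isMonoidMorphism.Build (fps int) (fps int) negps negps_is_monoid_morphism.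

Lemma negpsq : negps 'q = - 'q.
Proof. by apply/fpsP => -[|[|n]]; rewrite /= ?mulr0 // ?mulr1. Qed.

(** An infinite product is a q-adic limit, so [phi] is also required to respect congruence modulo
    q^N. *)
Lemma rmorph_qpoch (phi : {rmorphism fps int -> fps int}) (a x : fps int) :
  (forall N b c, eqps N b c -> eqps N (phi b) (phi c)) ->
  coefps x 0 = 0 -> coefps (phi x) 0 = 0 ->
  phi (qpoch a x) = qpoch (phi a) (phi x).
Proof.
move=> cont x0 phix0; apply: eqpsP => N n nN.
rewrite (cont N _ _ (eqps_qpoch a x0) n nN) -(qpochE _ phix0 nN) rmorph_prod.
congr (coefps _ n); apply: eq_bigr => i _.
by rewrite rmorphB rmorph1 rmorphM rmorphXn.
Qed.

Lemma subps_qpoch k a x : coefps x 0 = 0 ->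
  subps k (qpoch a x) = qpoch (subps k a) (subps k x).
Proof.
move=> x0; apply: rmorph_qpoch => //; last by rewrite coef_subpsE dvdn0 div0n.
move=> N b c bc n nN; rewrite !coef_subpsE; case: ifP => // _.
by apply: bc; apply: leq_ltn_trans nN; apply: leq_div.
Qed.

Lemma coefqX0 r : (0 < r)%N -> coefps ('q ^+ r) 0 = 0.
Proof. by rewrite coefpsqX; case: r. Qed.

Lemma subps_f k r : (0 < k)%N -> (0 < r)%N -> subps k (f_ r) = f_ (k * r).
Proof.
move=> k0 r0; rewrite /f_ (subps_qpoch _ _ (coefqX0 r0)).
by rewrite rmorphXn /= (subpsq k0) -exprM.
Qed.

Lemma negps_qpoch a x : coefps x 0 = 0 ->
  negps (qpoch a x) = qpoch (negps a) (negps x).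
Proof.
move=> x0; apply: rmorph_qpoch => //; last by rewrite coef_negps x0 mulr0.
by move=> N b c bc n nN; rewrite !coef_negps bc.
Qed.

(** [subps 2 A] lives on even exponents and ['q * subps 2 B] on odd ones. *)
Lemma dissection (a A B : fps int) : a = subps 2 A + 'q * subps 2 B ->
  (forall n, coefps a (2 * n) = coefps A n) /\
  (forall n, coefps a (2 * n + 1) = coefps B n).
Proof.
move=> ->; split=> n; rewrite coefpsD coefpsqM.
  rewrite coef_subps //; case: n => [|n]; first by rewrite muln0 addr0.
  by rewrite mulnS /= dvdn2 /= oddM /= addr0.
by rewrite addn1 coef_subps // /= dvdn2 /= oddM /= add0r.
Qed.

(** * Infinite products *)

Lemma coefXps0 (x : fps int) m : (0 < m)%N -> coefps x 0 = 0 -> coefps (x ^+ m) 0 = 0.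
Proof. by move=> m0 x0; rewrite coefps_order. Qed.

(** The factors are sorted by their index modulo [m]. *)
Lemma qpoch_split (m : nat) (a x : fps int) : (0 < m)%N -> coefps x 0 = 0 ->
  qpoch a x = \prod_(r < m) qpoch (a * x ^+ r) (x ^+ m).
Proof.
move=> m0 x0; apply: eqpsP => N n nN.
(* Truncating the left side at [N * m] factors gives complete blocks, so both sides become the same
   finite product. *)
have nNm : (n < N * m)%N by apply: leq_trans nN _; rewrite leq_pmulr.
rewrite -(qpochE _ x0 nNm).
rewrite (@eqps_prod _ N _ _ (fun r : 'I_m => qpoch (a * x ^+ r) (x ^+ m))
  (fun r : 'I_m => \prod_(k < N) (1 - a * x ^+ r * (x ^+ m) ^+ k))) //; last first.
  by move=> r; apply: eqps_qpoch; apply: coefXps0.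
congr (coefps _ n); elim: N {nN nNm} => [|N IHN].
  by rewrite mul0n big_ord0 big1 // => r _; rewrite big_ord0.
rewrite mulSn addnC big_split_ord /= IHN.
under [RHS]eq_bigr do rewrite big_ord_recr /=.
rewrite big_split /=; congr (_ * _); apply: eq_bigr => r _.
by rewrite -exprM -mulrA -exprD addnC mulnC.
Qed.

Lemma qpoch_peel (a x : fps int) : coefps x 0 = 0 ->
  qpoch a x = (1 - a) * qpoch (a * x) x.
Proof.
move=> x0; apply: eqpsP => N n nN.
rewrite -(qpochE _ x0 (leqW nN)) big_ord_recl expr0 mulr1.
rewrite (@eqpsM _ N (1 - a) (1 - a) (qpoch (a * x) x)
  (\prod_(k < N) (1 - a * x * x ^+ k))) //; last exact: eqps_qpoch.
by congr (coefps (_ * _) n); apply: eq_bigr => i _; rewrite exprS mulrA.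
Qed.

Lemma qpochMN (a x : fps int) : coefps x 0 = 0 ->
  qpoch a x * qpoch (- a) x = qpoch (a ^+ 2) (x ^+ 2).
Proof.
move=> x0; apply: eqpsP => N n nN.
rewrite (eqpsM (eqps_qpoch a (N:=N) x0) (eqps_qpoch (- a) (N:=N) x0)) //.
rewrite -(qpochE _ _ nN) ?coefXps0 // -big_split /=.
by congr (coefps _ n); apply: eq_bigr => i _; rewrite exprAC; ring.
Qed.

Lemma f_odd r : (0 < r)%N -> qpoch ('q ^+ r) ('q ^+ (2 * r)) * f_ (2 * r) = f_ r.
Proof.
move=> r0; rewrite /f_ [RHS](qpoch_split _ (isT : (0 < 2)%N) (coefqX0 r0)).
rewrite !big_ord_recl big_ord0 expr0 !mulr1 expr1 -exprD -exprM [(r * 2)%N]mulnC.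
by rewrite addnn -mul2n.
Qed.

Lemma f_neg r : (0 < r)%N -> qpoch (- 'q ^+ r) ('q ^+ r) * f_ r = f_ (2 * r).
Proof.
move=> r0; rewrite /f_ mulrC (qpochMN _ (coefqX0 r0)).
by rewrite -exprM mulnC.
Qed.

Lemma f_negodd r : (0 < r)%N ->
  qpoch (- 'q ^+ r) ('q ^+ (2 * r)) * f_ r * f_ (4 * r) = f_ (2 * r) ^+ 2.
Proof.
move=> r0; have r20 : (0 < 2 * r)%N by rewrite muln_gt0.
rewrite -{1}(f_odd r0) expr2 -{2}(f_odd r20).
rewrite -[4%N]/(2 * 2)%N -mulnA.
have := qpochMN ('q ^+ r) (coefqX0 r20).
rewrite -!exprM [(r * 2)%N]mulnC [(2 * r * 2)%N]mulnC => <-.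
move: (qpoch _ _) (qpoch _ _) (f_ _) (f_ _) => a b c d; ring.
Qed.

Lemma qpoch_split3 (a : fps int) r : (0 < r)%N ->
  qpoch a ('q ^+ r) = qpoch a ('q ^+ (3 * r)) * qpoch (a * 'q ^+ r) ('q ^+ (3 * r))
                      * qpoch (a * 'q ^+ (2 * r)) ('q ^+ (3 * r)).
Proof.
move=> r0; rewrite (qpoch_split a (isT : (0 < 3)%N) (coefqX0 r0)).
rewrite !big_ord_recl big_ord0 expr0 !mulr1 mulrA.
by rewrite [(3 * r)%N]mulnC [(2 * r)%N]mulnC !exprM.
Qed.

Lemma negps_feven r : (0 < r)%N -> negps (f_ (2 * r)) = f_ (2 * r).
Proof.
move=> r0; rewrite /f_ negps_qpoch; last by rewrite coefqX0 // muln_gt0.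
by rewrite rmorphXn /= negpsq exprM sqrrN -exprM.
Qed.

(** Under q -> - q the product (q^r; q^(2r)) becomes (- q^r; q^(2r)), whence f_r(- q) = f_(2r)^3 /
    (f_r f_(4r)), here without denominators. *)
Lemma negps_fodd r : odd r ->
  negps (f_ r) * f_ r * f_ (4 * r) = f_ (2 * r) ^+ 3.
Proof.
move=> or; have r0 : (0 < r)%N by case: r or.
rewrite -{1}(f_odd r0) rmorphM /= (negps_feven r0) exprSr -(f_negodd r0).
rewrite negps_qpoch; last by rewrite coefqX0 // muln_gt0.
rewrite !rmorphXn /= negpsq exprM sqrrN -exprM exprNn -signr_odd or expr1 mulN1r.
move: (qpoch _ _) (f_ _) (f_ _) (f_ _) => a b c d; ring.
Qed.

(** * Series indexed by a set *)

(* The sum \sum_i w(i) q^e(i). If infinitely many indices of nonzero weight     *)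
(* share an exponent, the sum over [\in] takes the junk value 0 there.          *)
Definition genps (I : choiceType) (w : I -> int) (e : I -> nat) : fps int :=
  FPS (fun n => \sum_(i \in [set: I]%classic) (if e i == n then w i else 0)).

(** Under this condition no coefficient of [genps] is a junk value. The inequality lets the same
    finite lists serve both factors of a Cauchy product. *)
Definition locfin (I : choiceType) (e : I -> nat) :=
  forall n, exists2 r : seq I, uniq r & forall i, (e i <= n)%N -> i \in r.

Lemma coef_genps (I : choiceType) (w : I -> int) (e : I -> nat) n (r : seq I) :
  uniq r -> (forall i, e i = n -> i \in r) ->
  coefps (genps w e) n = \sum_(i <- r) (if e i == n then w i else 0).
Proof.
move=> ur rP; rewrite /= (fsbigE r) //=.
  by apply: eq_bigl => i; rewrite in_setT.
by move=> i _; case: eqP => // /rP ->.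
Qed.

Lemma eq_genps (I : choiceType) (w v : I -> int) (e g : I -> nat) :
  w =1 v -> e =1 g -> genps w e = genps v g.
Proof. by move=> /funext -> /funext ->. Qed.

Lemma genps_shift (I : choiceType) (w : I -> int) (e : I -> nat) m :
  locfin e -> genps w (fun i => m + e i)%N = 'q ^+ m * genps w e.
Proof.
move=> le; apply/fpsP => n; rewrite coefpsqXM.
have [r ur rP] := le n.
rewrite (@coef_genps _ _ _ _ r) //; last first.
  by move=> i ein; apply: rP; rewrite -ein leq_addl.
case: leqP => mn.
  rewrite (@coef_genps _ _ _ _ r) //; last first.
    by move=> i ein; apply: rP; rewrite ein leq_subr.
  by apply: eq_bigr => i _; rewrite -(eqn_add2l m (e i)) subnKC.
by rewrite big1 // => i _; case: eqP => // mei; move: mn; rewrite -mei ltnNge leq_addr.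
Qed.

Lemma genpsM (I J : choiceType) (w : I -> int) (e : I -> nat)
    (v : J -> int) (g : J -> nat) : locfin e -> locfin g ->
  genps w e * genps v g =
  genps (fun ij : I * J => w ij.1 * v ij.2) (fun ij : I * J => e ij.1 + g ij.2)%N.
Proof.
move=> le lg; apply/fpsP => n; rewrite coefpsM.
have [r ur rP] := le n; have [t ut tP] := lg n.
rewrite (@coef_genps _ _ _ _ [seq (i, j) | i <- r, j <- t]); first last.
- move=> [i j] /= eg; apply/allpairsP; exists (i, j); split=> //=.
    by apply: rP; rewrite -eg leq_addr.
  by apply: tP; rewrite -eg leq_addl.
- by apply: allpairs_uniq => // -[? ?] [? ?] /=.
rewrite big_allpairs.
transitivity (\sum_(k < n.+1) \sum_(i <- r) \sum_(j <- t)
   (if e i == k then w i else 0) * (if g j == (n - k)%N then v j else 0)).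
  apply: eq_bigr => k _.
  rewrite (@coef_genps _ _ _ _ r) //; last first.
    by move=> i ei; apply: rP; rewrite ei -ltnS.
  rewrite (@coef_genps _ _ _ _ t) //; last first.
    by move=> j gj; apply: tP; rewrite gj leq_subr.
  by rewrite mulr_suml; apply: eq_bigr => i _; rewrite mulr_sumr.
rewrite exchange_big; apply: eq_bigr => i _.
rewrite exchange_big; apply: eq_bigr => j _ /=.
have [ein|nei] := leqP (e i) n; last first.
  rewrite big1 => [|k _]; last first.
    case: eqP => [ek|]; rewrite ?mul0r //.
    by move: nei; rewrite ek ltnNge -ltnS ltn_ord.
  by case: eqP => // eg; move: nei; rewrite -eg ltnNge leq_addr.
have ein' : (e i < n.+1)%N by [].
rewrite (bigD1 (Ordinal ein')) //= eqxx big1 => [|k ki].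
  rewrite addr0 -(eqn_add2l (e i) (g j)) subnKC //.
  by case: eqP; rewrite ?mulr0.
rewrite ifF ?mul0r //; apply: contraNF ki => /eqP ek.
by apply/eqP/val_inj.
Qed.

(** The injections [h1] and [h2] have complementary images; every theta dissection below is an
    instance. *)
Lemma genps_split (I J K : choiceType) (w : I -> int) (e : I -> nat)
    (h1 : J -> I) (h2 : K -> I) : injective h1 -> injective h2 ->
  (forall j k, h1 j <> h2 k) ->
  (forall i, (exists j, i = h1 j) \/ (exists k, i = h2 k)) ->
  locfin (e \o h1) -> locfin (e \o h2) ->
  genps w e = genps (w \o h1) (e \o h1) + genps (w \o h2) (e \o h2).
Proof.
move=> i1 i2 h12 h l1 l2; apply/fpsP => n; rewrite coefpsD.
have [r ur rP] := l1 n; have [t ut tP] := l2 n.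
rewrite (@coef_genps _ _ _ _ r) //; last by move=> j /= ej; apply: rP; rewrite /= ej.
rewrite (@coef_genps _ _ (e \o h2) _ t) //; last by move=> j /= ej; apply: tP; rewrite /= ej.
rewrite (@coef_genps _ _ _ _ (map h1 r ++ map h2 t)); first last.
- move=> i ei; rewrite mem_cat.
  case: (h i) => [] [j ij]; rewrite ij map_f ?orbT //.
    by apply: rP; rewrite /= -ij ei.
  by apply: tP; rewrite /= -ij ei.
- rewrite cat_uniq !map_inj_uniq // ur ut /= andbT; apply/hasPn => i /mapP[k _ ->].
  by apply/mapP => -[j _] /esym; apply: h12.
by rewrite big_cat !big_map.
Qed.

(** * Theta series *)

(** The absolute value is only a cast to [nat]: for [d <= c] the form is nonnegative at every
    integer ([qexpE]). *)
Definition qexp (c d : nat) (k : int) : nat := absz (c%:Z * k ^+ 2 + d%:Z * k).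

(* With s = (-1)^b this is Ramanujan's f(s q^(c + d), s q^(c - d)). *)
Definition theta (b : bool) (c d : nat) : fps int :=
  genps (fun k : int => (-1) ^+ (b * absz k)%N) (qexp c d).

Lemma qexpE c d k : (d <= c)%N -> (qexp c d k)%:Z = c%:Z * k ^+ 2 + d%:Z * k.
Proof.
move=> dc; rewrite /qexp gez0_abs // expr2.
have [k0|k0] : 0 <= k \/ k + 1 <= 0 by lia.
  by rewrite addr_ge0 ?mulr_ge0.
(* For k <= -1 both summands of this rearrangement are nonnegative. *)
have -> : c%:Z * (k * k) + d%:Z * k = c%:Z * (k * (k + 1)) + (c%:Z - d%:Z) * (- k) by ring.
rewrite addr_ge0 //; first by rewrite mulr_ge0 // mulr_le0 //; lia.
by rewrite mulr_ge0 //; lia.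
Qed.

(** This linear bound makes the exponents locally finite. The successor is there for k = -1 and c =
    d, where the exponent is 0. *)
Lemma qexp_ge c d k : (0 < c)%N -> (d <= c)%N -> (absz k <= (qexp c d k).+1)%N.
Proof.
move=> c0 dc; have := qexpE k dc; rewrite expr2.
have [k0|k0] : 0 <= k \/ k + 1 <= 0 by lia.
  have := mulr_ge0 (ler0n int d) k0.
  have : 0 <= (c%:Z - 1) * (k * k) by rewrite mulr_ge0 ?mulr_ge0 //; lia.
  by nia.
have : 0 <= (c%:Z - d%:Z) * (- k) by rewrite mulr_ge0; lia.
have : 0 <= (c%:Z - 1) * (k * (k + 1)) by rewrite mulr_ge0 // ?mulr_le0 //; lia.
by nia.
Qed.

Lemma locfin_qexp c d : (0 < c)%N -> (d <= c)%N -> locfin (qexp c d).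
Proof.
move=> c0 dc n; exists [seq i%:Z - n.+1%:Z | i <- iota 0 (2 * n + 3)].
  by rewrite map_inj_uniq ?iota_uniq // => i j; lia.
move=> k kn; have := qexp_ge k c0 dc => kb.
apply/mapP; exists (absz (k + n.+1%:Z)); first by rewrite mem_iota; lia.
by lia.
Qed.

Lemma locfin_prod (I J : choiceType) (e : I -> nat) (g : J -> nat) :
  locfin e -> locfin g -> locfin (fun ij : I * J => e ij.1 + g ij.2)%N.
Proof.
move=> le lg n; have [r ur rP] := le n; have [t ut tP] := lg n.
exists [seq (i, j) | i <- r, j <- t].
  by apply: allpairs_uniq => // -[? ?] [? ?] /=.
move=> [i j] /= eg; apply/allpairsP; exists (i, j); split=> //=.
  by apply: rP; apply: leq_trans eg; rewrite leq_addr.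
by apply: tP; apply: leq_trans eg; rewrite leq_addl.
Qed.

Lemma locfin_shift (I : choiceType) (e : I -> nat) m :
  locfin e -> locfin (fun i => m + e i)%N.
Proof.
move=> le n; have [r ur rP] := le n; exists r => // i ei.
by apply: rP; apply: leq_trans ei; rewrite leq_addl.
Qed.

(** * The Jacobi triple product *)

(** The Gaussian binomial coefficient, defined by the q-Pascal rule so as to make sense in any
    commutative ring. *)
Fixpoint qbin (R : comNzRingType) (p : R) (n j : nat) : R :=
  match n, j with
  | _, 0 => 1
  | 0, _ => 0
  | m.+1, i.+1 => p ^+ j * qbin p m j + qbin p m i
  end.

Arguments qbin : simpl never.

Lemma qbin0 (R : comNzRingType) (p : R) n : qbin p n 0 = 1.
Proof. by case: n. Qed.

Lemma qbinS (R : comNzRingType) (p : R) n j :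
  qbin p n.+1 j.+1 = p ^+ j.+1 * qbin p n j.+1 + qbin p n j.
Proof. by []. Qed.

Lemma qbin_small (R : comNzRingType) (p : R) n j : (n < j)%N -> qbin p n j = 0.
Proof.
elim: n j => [|n IHn] [|j] // nj.
by rewrite qbinS !IHn ?mulr0 ?addr0 // ltnW.
Qed.

(** The q-binomial theorem, by induction: without its first factor the product is the shorter one at
    [x * p]. The form homogeneous in [x] and [y] allows [y] to be a power of q later, which avoids
    negative exponents. *)
Lemma qbinomial (R : comNzRingType) (p x y : R) n :
  \prod_(i < n) (y + x * p ^+ i) =
  \sum_(j < n.+1) p ^+ 'C(j, 2) * qbin p n j * x ^+ j * y ^+ (n - j).
Proof.
elim: n x => [|n IHn] x.
  by rewrite big_ord0 big_ord1 /= !mulr1.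
rewrite big_ord_recl expr0 mulr1.
under eq_bigr do rewrite exprS mulrA.
rewrite IHn mulrDl [RHS]big_ord_recl /= qbin0 subn0.
under [X in _ = _ + X]eq_bigr => i _.
  rewrite /bump /= add1n qbinS subSS mulrDr !mulrDl.
  over.
rewrite big_split /= addrA; congr (_ + _).
  rewrite big_ord_recl /= qbin0 subn0 !mulr1 expr0 mul1r mulrDr -exprS.
  congr (_ + _); first by rewrite mul1r.
  rewrite big_ord_recr /= qbin_small ?mulr0 ?mul0r ?addr0 //.
  rewrite mulr_sumr; apply: eq_bigr => i _; rewrite /bump /= add1n.
  have -> : (n - i = (n - i.+1).+1)%N by have := ltn_ord i; lia.
  by rewrite exprMn !exprS; ring.
rewrite mulr_sumr; apply: eq_bigr => i _.
by rewrite exprMn binS bin1 exprD !exprS; ring.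
Qed.

(** The formula (p; p)_(m+j) / ((p; p)_j (p; p)_m) without denominators. *)
Lemma qbin_prod (R : comNzRingType) (p : R) m j :
  qbin p (m + j) j * \prod_(i < j) (1 - p * p ^+ i) * \prod_(i < m) (1 - p * p ^+ i)
  = \prod_(i < m + j) (1 - p * p ^+ i).
Proof.
move En: (m + j)%N => n; elim: n m j En => [|n IHn] [|m] [|j] // En.
- by rewrite big_ord0 !mulr1.
- rewrite add0n in En; rewrite -En big_ord0 mulr1.
  rewrite qbinS qbin_small // mulr0 add0r.
  have := IHn 0%N j; rewrite add0n big_ord0 mulr1.
  case: En => <- /(_ erefl) qj; rewrite big_ord_recr /= mulrA qj; ring.
- by rewrite addn0 in En; rewrite -En qbin0 big_ord0 !mul1r.
have En1 : (m + j.+1 = n)%N by lia.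
have En2 : (m.+1 + j = n)%N by lia.
rewrite qbinS [RHS]big_ord_recr /=.
rewrite !mulrDl.
have -> : p ^+ j.+1 * qbin p n j.+1 * \prod_(i < j.+1) (1 - p * p ^+ i)
   * \prod_(i < m.+1) (1 - p * p ^+ i) =
   p ^+ j.+1 * (1 - p * p ^+ m) * \prod_(i < n) (1 - p * p ^+ i).
  by rewrite -(IHn _ _ En1) [X in _ * X]big_ord_recr /=; ring.
rewrite -(IHn _ _ En2) [\prod_(i < j.+1) _]big_ord_recr /=.
move: (\prod_(i < j) _) (\prod_(i < m.+1) _) => a b.
by rewrite -En2 addSn -addnS exprD !exprS; ring.
Qed.

Lemma qX_inj m (a b : fps int) : 'q ^+ m * a = 'q ^+ m * b -> a = b.
Proof.
move=> /fpsP ab; apply/fpsP => n; have := ab (m + n)%N.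
by rewrite !coefpsqXM leq_addr addKn.
Qed.

Lemma coefps_sign k (a : fps int) n :
  coefps ((-1) ^+ k * a) n = (-1) ^+ k * coefps a n.
Proof.
elim: k => [|k IHk]; first by rewrite !mul1r.
by rewrite !exprS -!mulrA mulN1r coefpsN IHk mulN1r.
Qed.

Lemma mul2bin2 j : (2 * 'C(j, 2) = j * j.-1)%N.
Proof. by elim: j => // j IHj; rewrite binS bin1 mulnDr IHj; case: j {IHj} => //= j; lia. Qed.

Lemma mul2bin2z j : 2 * 'C(j, 2)%:Z = j%:Z * (j%:Z - 1).
Proof.
rewrite -[2]/(2%:Z) -PoszM mul2bin2; case: j => [|j] //=.
by rewrite PoszM -addn1 PoszD addrK.
Qed.

(** The q-binomial theorem with 2N factors, x = s and y = q^u, where u = 2cN - c - d centres the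
    product. Extracting q^u from the upper N factors leaves those in q^(c+d); extracting s p^i from
    the lower N and reversing their order leaves those in q^(c-d). *)
Lemma jtp_finite (b : bool) (c d N : nat) : (d <= c)%N -> (0 < N)%N ->
  let s : fps int := (-1) ^+ b in
  \prod_(i < N) (1 + s * 'q ^+ (c + d) * ('q ^+ (2 * c)) ^+ i)
  * \prod_(i < N) (1 + s * 'q ^+ (c - d) * ('q ^+ (2 * c)) ^+ i) =
  \sum_(j < (2 * N).+1) (-1) ^+ (b * absz (j%:Z - N%:Z)%R)%N
     * ('q ^+ qexp c d (j%:Z - N%:Z) * qbin ('q ^+ (2 * c)) (2 * N) j).
Proof.
move=> dc N0 s; set p := 'q ^+ (2 * c); pose u := (2 * c * N - c - d)%N.
have ss : s * s = 1 by rewrite -expr2 sqrr_sign.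
have cN : (2 * c <= 2 * c * N)%N by rewrite leq_pmulr.
have uE : u%:Z = 2 * c%:Z * N%:Z - c%:Z - d%:Z by rewrite /u; lia.
have constN (x : fps int) : x ^+ N = \prod_(i < N) x.
  by rewrite prodr_const card_ord.
have H := qbinomial p s ('q ^+ u) (2 * N).
have H1 : \prod_(i < 2 * N) ('q ^+ u + s * p ^+ i) =
   'q ^+ (u * N + 2 * c * 'C(N, 2)) * s ^+ N *
  (\prod_(i < N) (1 + s * 'q ^+ (c + d) * p ^+ i)
  * \prod_(i < N) (1 + s * 'q ^+ (c - d) * p ^+ i)).
  rewrite mul2n -addnn big_split_ord /=.
  have -> : \prod_(i < N) ('q ^+ u + s * p ^+ (N + i)) =
     'q ^+ (u * N) * \prod_(i < N) (1 + s * 'q ^+ (c + d) * p ^+ i).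
    rewrite exprM constN -big_split /=; apply: eq_bigr => i _.
    have -> : p ^+ (N + i) = 'q ^+ u * 'q ^+ (c + d) * p ^+ i.
      by rewrite /p -!exprM -!exprD; congr (_ ^+ _); rewrite /u; nia.
    by move: ('q ^+ u) ('q ^+ _) (p ^+ _) => x y z; ring.
  have -> : \prod_(i < N) ('q ^+ u + s * p ^+ i) =
     s ^+ N * p ^+ 'C(N, 2) * \prod_(i < N) (1 + s * 'q ^+ (c - d) * p ^+ i).
    rewrite -bin2_sum big_mkord -prodrXr constN -big_split /=.
    rewrite [X in _ = _ * X](reindex_inj rev_ord_inj) -big_split /=.
    apply: eq_bigr => i _.
    have -> : 'q ^+ u = p ^+ i * ('q ^+ (c - d) * p ^+ (N - i.+1)).
      rewrite /p -!exprM -!exprD; congr (_ ^+ _).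
      by have := ltn_ord i; rewrite /u; nia.
    by move: (p ^+ _) (p ^+ _) ('q ^+ _) => x y z; ring: ss.
  rewrite (exprD 'q (u * N)) (exprM 'q (2 * c)) -/p.
  move: ('q ^+ (u * N)) (p ^+ 'C(N, 2)) (s ^+ N) (\prod_(i < N) _) (\prod_(i < N) _).
  by move=> A B C D E; ring.
rewrite H1 in H; move: H; rewrite -mulrA => H.
(* The extracted power of q cancels on both sides; the extracted sign [s ^+ N] is its own
   inverse. *)
apply: (@qX_inj (u * N + 2 * c * 'C(N, 2))).
transitivity (s ^+ N * ('q ^+ (u * N + 2 * c * 'C(N, 2)) * (s ^+ N *
  (\prod_(i < N) (1 + s * 'q ^+ (c + d) * p ^+ i)
   * \prod_(i < N) (1 + s * 'q ^+ (c - d) * p ^+ i))))).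
  have : s ^+ N * s ^+ N = 1 by rewrite -exprMn ss expr1n.
  move: ('q ^+ (u * N + _)) (s ^+ N) (\prod_(i < N) _) (\prod_(i < N) _).
  by move=> A C B D CC; ring: CC.
rewrite H !mulr_sumr; apply: eq_bigr => j _.
have es : s ^+ N * s ^+ j = (-1) ^+ (b * absz (j%:Z - N%:Z)%R)%N.
  rewrite -exprD -exprM -[LHS]signr_odd -[RHS]signr_odd !oddM.
  by have -> : odd (N + j) = odd (absz (j%:Z - N%:Z)) by lia.
(* Completing the square: c j(j-1) + u(2N-j) = uN + c N(N-1) + c(j-N)^2 + d(j-N). *)
have ep : p ^+ 'C(j, 2) * 'q ^+ u ^+ (2 * N - j) =
    'q ^+ (u * N + 2 * c * 'C(N, 2)) * 'q ^+ qexp c d (j%:Z - N%:Z).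
  rewrite /p -!exprM -!exprD; congr (_ ^+ _); apply/eqP; rewrite -eqz_nat; apply/eqP.
  have jN : (j <= 2 * N)%N by rewrite -ltnS.
  rewrite !PoszD !PoszM (qexpE _ dc) uE -subzn // PoszM.
  rewrite ![Posz 2 * c%:Z]mulrC -!mulrA !mul2bin2z; ring.
rewrite -es; move: ep; move: (s ^+ N) (s ^+ j) ('q ^+ (u * N + _)) ('q ^+ qexp _ _ _)
  ('q ^+ u ^+ _) (p ^+ _) (qbin _ _ _).
move=> A B E F D C G CD.
transitivity (A * B * G * (C * D)); first by ring.
by rewrite CD; ring.
Qed.

(** In [qbin_prod] all three finite products agree with [f_ c] to this order, and [f_ c] is a unit
    and cancels. *)
Lemma qbin_lim c n j : (0 < c)%N -> (j <= n)%N ->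
  eqps (minn j (n - j)) (qbin ('q ^+ c) n j * f_ c) 1.
Proof.
move=> c0 jn; set p := 'q ^+ c; set M := minn _ _.
have lim m : (M <= m)%N -> eqps M (\prod_(i < m) (1 - p * p ^+ i)) (f_ c).
  by move=> Mm k kM; rewrite -(qpochE _ (coefqX0 c0) (leq_trans kM Mm)).
have := qbin_prod p (n - j) j; rewrite subnK // => H.
have E : eqps M (qbin p n j * f_ c * f_ c) (f_ c).
  move=> k kM; rewrite -[RHS](lim n) //; last by rewrite /M geq_min jn.
  rewrite -H; apply/esym; apply: (@eqpsM _ M) => //; last by apply: lim; rewrite geq_minr.
  by apply: eqpsM => //; apply: lim; rewrite geq_minl.
have uf := f_unit c0.
have E' : eqps M (qbin p n j * f_ c * f_ c * (f_ c)^-1) (f_ c * (f_ c)^-1) by apply: eqpsM.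
by move: E'; rewrite mulrK // divrr.
Qed.

(** The limit of [jtp_finite]: multiplied by [f_ (2 * c)], each Gaussian binomial tends to 1. *)
Theorem jacobi_triple_product (b : bool) (c d : nat) : (0 < c)%N -> (d <= c)%N ->
  theta b c d =
  qpoch (- ((-1) ^+ b * 'q ^+ (c + d))) ('q ^+ (2 * c))
  * qpoch (- ((-1) ^+ b * 'q ^+ (c - d))) ('q ^+ (2 * c)) * f_ (2 * c).
Proof.
(* As |k| may exceed its exponent by one, one factor more than [M] is taken; [qbin_lim] is then
   precise enough at every index that contributes. *)
move=> c0 dc; apply/esym/eqpsP => M n nM; pose N := M.+1.
have p0 : coefps ('q ^+ (2 * c)) 0 = 0 by rewrite coefqX0 // muln_gt0.
have N0 : (0 < N)%N by [].
have sgn (x y : fps int) : \prod_(i < N) (1 - - x * y ^+ i) = \prod_(i < N) (1 + x * y ^+ i).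
  by apply: eq_bigr => i _; rewrite mulNr opprK.
have EM (a : fps int) := eqps_sub (leqnSn M) (eqps_qpoch a (N := N) p0).
rewrite (eqpsM (eqpsM (EM _) (EM _)) (fun k _ => erefl (coefps (f_ (2 * c)) k))) //.
rewrite !sgn (jtp_finite _ dc N0) mulr_suml coefps_sum.
rewrite (@coef_genps _ _ _ _ [seq i%:Z - N%:Z | i <- index_iota 0 (2 * N).+1]); first last.
- move=> k kn; have := qexp_ge k c0 dc => kb.
  apply/mapP; exists (absz (k + N%:Z)); first by rewrite mem_index_iota /N; lia.
  by rewrite /N; lia.
- by rewrite map_inj_uniq ?iota_uniq // => i j; lia.
rewrite big_map big_mkord; apply: eq_bigr => j _.
rewrite -!mulrA coefps_sign coefpsqXM.
have jN : (j <= 2 * N)%N by rewrite -ltnS.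
case: leqP => en; last first.
  by rewrite mulr0; case: eqP => // ee; move: en; rewrite ee ltnn.
have c20 : (0 < 2 * c)%N by rewrite muln_gt0.
rewrite (qbin_lim c20 jN); last first.
  have := qexp_ge (j%:Z - N%:Z) c0 dc; rewrite leq_min /N => eb.
  by apply/andP; split; rewrite /N in jN en *; lia.
rewrite coefps1 subn_eq0 [_ == n]eqn_leq en /=.
by case: leqP; rewrite ?mulr0 ?mulr1.
Qed.

(** * Theta identities *)

(** Even indices are written 2k and odd ones - (2k + 1); this sign turns the odd exponents into (c -
    d) + 4c k^2 + (4c - 2d) k, again with linear coefficient between 0 and 4c. *)
Lemma theta_dissection (c d : nat) : (0 < c)%N -> (d <= c)%N ->
  theta false c d =
  theta false (4 * c) (2 * d) + 'q ^+ (c - d) * theta false (4 * c) (4 * c - 2 * d).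
Proof.
move=> c0 dc; have c40 : (0 < 4 * c)%N by lia.
have d1 : (2 * d <= 4 * c)%N by lia.
have d2 : (4 * c - 2 * d <= 4 * c)%N by lia.
have e1 k : qexp c d (2 * k) = qexp (4 * c) (2 * d) k.
  apply/eqP; rewrite -eqz_nat; apply/eqP; rewrite !qexpE // !PoszM; ring.
have e2 k : qexp c d (- (2 * k + 1)) = (c - d + qexp (4 * c) (4 * c - 2 * d) k)%N.
  apply/eqP; rewrite -eqz_nat; apply/eqP; rewrite PoszD !qexpE // -!subzn // !PoszM; ring.
rewrite -genps_shift; last exact: locfin_qexp.
rewrite /theta (@genps_split _ _ _ _ (qexp c d) (fun k : int => 2 * k)
  (fun k : int => - (2 * k + 1))); first last.
- by rewrite (funext e2 : _ \o _ = _); apply: locfin_shift; apply: locfin_qexp.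
- by rewrite (funext e1 : _ \o _ = _); apply: locfin_qexp.
- move=> i; have [i0|i0] : (exists k, i = 2 * k) \/ (exists k, i = - (2 * k + 1)).
  + have [->|->] : i = 2 * (i %/ 2)%Z \/ i = - (2 * (- ((i + 1) %/ 2)%Z) + 1) by lia.
      by left; eexists.
    by right; eexists.
  + by left.
  + by right.
- by move=> j k; lia.
- by move=> j k; lia.
- by move=> j k; lia.
by congr (_ + _); apply: eq_genps.
Qed.

(* The substitution (m, n) = (a - b, a + b) or (b - a, - a - b - 1), according  *)
(* to the parity of m + n, diagonalises the quadratic form.                     *)
Lemma theta_product :
  theta true 3 0 * theta false 3 2 = theta true 6 2 ^+ 2 + 'q * theta true 6 4 ^+ 2.
Proof.
have l30 : locfin (qexp 3 0) by apply: locfin_qexp.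
have l32 : locfin (qexp 3 2) by apply: locfin_qexp.
have l62 : locfin (qexp 6 2) by apply: locfin_qexp.
have l64 : locfin (qexp 6 4) by apply: locfin_qexp.
have L2 := locfin_prod l62 l62; have L4 := locfin_prod l64 l64.
rewrite !expr2 /theta !genpsM // -['q]expr1 -genps_shift //.
pose h1 (k : int * int) : int * int := (k.1 - k.2, k.1 + k.2).
pose h2 (k : int * int) : int * int := (k.2 - k.1, - k.1 - k.2 - 1).
have e1 k : (qexp 3 0 (h1 k).1 + qexp 3 2 (h1 k).2)%N = (qexp 6 2 k.1 + qexp 6 2 k.2)%N.
  by apply/eqP; rewrite -eqz_nat; apply/eqP; rewrite !PoszD !qexpE //=; ring.
have e2 k : (qexp 3 0 (h2 k).1 + qexp 3 2 (h2 k).2)%N = (1 + (qexp 6 4 k.1 + qexp 6 4 k.2))%N.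
  by apply/eqP; rewrite -eqz_nat; apply/eqP; rewrite !PoszD !qexpE //=; ring.
rewrite (@genps_split _ _ _ _ _ h1 h2); first last.
- by rewrite (funext e2 : _ \o _ = _); apply: locfin_shift.
- by rewrite (funext e1 : _ \o _ = _).
- move=> [m n].
  have [e|e] : (m + n = 2 * ((m + n) %/ 2)%Z) \/ (m + n = 2 * ((m + n) %/ 2)%Z + 1) by lia.
    left; exists (((m + n) %/ 2)%Z, n - ((m + n) %/ 2)%Z).
    by rewrite /h1 /=; congr (_, _); lia.
  right; exists (- ((m + n) %/ 2)%Z - 1, m - ((m + n) %/ 2)%Z - 1).
  by rewrite /h2 /=; congr (_, _); lia.
- by move=> [j j'] [k k'] []; lia.
- by move=> [j j'] [k k'] [] *; congr (_, _); lia.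
- by move=> [j j'] [k k'] [] *; congr (_, _); lia.
have sgn (x y : int) : (-1) ^+ absz (x - y) = (-1) ^+ absz x * (-1) ^+ absz y :> int.
  rewrite -exprD -signr_odd -[RHS]signr_odd.
  by have -> : odd (absz (x - y)) = odd (absz x + absz y) by lia.
congr (_ + _); apply: eq_genps => //.
  by move=> [x y] /=; rewrite !mul1n mul0n mulr1 sgn.
by move=> [x y] /=; rewrite !mul1n mul0n mulr1 sgn mulrC.
Qed.

(** The factor of index 0 is 1 + 1, the source of the 2 in [theta_psi]. *)
Lemma qpoch_neg1 r : (0 < r)%N ->
  qpoch (- 1) ('q ^+ r) = 2 * qpoch (- 'q ^+ r) ('q ^+ r).
Proof. by move=> r0; rewrite qpoch_peel ?coefqX0 // opprK mulN1r. Qed.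

(** The product formula for phi(q^r), cleared of denominators like those that follow. *)
Lemma theta_phi r : (0 < r)%N ->
  theta false r 0 * f_ r ^+ 2 * f_ (4 * r) ^+ 2 = f_ (2 * r) ^+ 5.
Proof.
move=> r0; rewrite (jacobi_triple_product _ r0 (leq0n r)) expr0 !mul1r addn0 subn0.
have := f_negodd r0.
move: (qpoch _ _) (f_ r) (f_ (2 * r)) (f_ (4 * r)) => P a b c E.
by transitivity ((P * a * c) ^+ 2 * b); [ring | rewrite E; ring].
Qed.

Lemma theta_phin r : (0 < r)%N -> theta true r 0 * f_ (2 * r) = f_ r ^+ 2.
Proof.
move=> r0; rewrite (jacobi_triple_product _ r0 (leq0n r)) expr1 !mulN1r !opprK addn0 subn0.
by rewrite -(f_odd r0); move: (qpoch _ _) (f_ _) => P a; ring.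
Qed.

(** The series is f(q^(2r), 1) = 2 psi(q^(2r)), since k and - k - 1 share an exponent. *)
Lemma theta_psi r : (0 < r)%N -> theta false r r * f_ (2 * r) = 2 * f_ (4 * r) ^+ 2.
Proof.
move=> r0; have r20 : (0 < 2 * r)%N by lia.
rewrite (jacobi_triple_product _ r0 (leqnn r)) expr0 !mul1r subnn addnn -mul2n expr0.
rewrite qpoch_neg1 //; have := f_neg r20; rewrite mulnA => <-.
by move: (qpoch _ _) (f_ _) => P a; ring.
Qed.

Lemma qpoch_split3N r : (0 < r)%N ->
  qpoch (- 'q ^+ r) ('q ^+ (2 * r)) =
  qpoch (- 'q ^+ r) ('q ^+ (6 * r)) * qpoch (- 'q ^+ (3 * r)) ('q ^+ (6 * r))
  * qpoch (- 'q ^+ (5 * r)) ('q ^+ (6 * r)).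
Proof.
move=> r0; have r20 : (0 < 2 * r)%N by lia.
rewrite (qpoch_split3 _ r20) !mulNr -!exprD.
have -> : (r + 2 * r = 3 * r)%N by lia.
have -> : (r + 2 * (2 * r) = 5 * r)%N by lia.
by have -> : (3 * (2 * r) = 6 * r)%N by lia.
Qed.

Lemma qpoch_split3P r : (0 < r)%N ->
  qpoch ('q ^+ r) ('q ^+ (2 * r)) =
  qpoch ('q ^+ r) ('q ^+ (6 * r)) * qpoch ('q ^+ (3 * r)) ('q ^+ (6 * r))
  * qpoch ('q ^+ (5 * r)) ('q ^+ (6 * r)).
Proof.
move=> r0; have r20 : (0 < 2 * r)%N by lia.
rewrite (qpoch_split3 _ r20) -!exprD.
have -> : (r + 2 * r = 3 * r)%N by lia.
have -> : (r + 2 * (2 * r) = 5 * r)%N by lia.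
by have -> : (3 * (2 * r) = 6 * r)%N by lia.
Qed.

(** For f(q^r, q^(5r)) the triple product involves the residues 1 and 5 modulo 6, that is, the odd
    residues without the class of 3. *)
Lemma theta_15 r : (0 < r)%N ->
  theta false (3 * r) (2 * r) * f_ r * f_ (4 * r) * f_ (6 * r)
  = f_ (2 * r) ^+ 2 * f_ (3 * r) * f_ (12 * r).
Proof.
move=> r0; have r30 : (0 < 3 * r)%N by lia.
rewrite jacobi_triple_product; [|lia|lia].
rewrite expr0 !mul1r -mulnDl -mulnBl mul1n mulnA.
have := f_negodd r30; rewrite !mulnA => E3.
rewrite -(f_negodd r0) (qpoch_split3N r0); move: E3.
rewrite -[(3 + 2)%N]/5%N -[(2 * 3)%N]/6%N -[(4 * 3)%N]/12%N.
move: (f_ r) (f_ (4 * r)) (f_ (3 * r)) (f_ (6 * r)) (f_ (12 * r)).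
move: (qpoch _ ('q ^+ (6 * r))) (qpoch (- 'q ^+ r) _) (qpoch (- 'q ^+ (3 * r)) _).
move=> C A B a b c d e E.
by transitivity (C * A * a * b * d ^+ 2); [ring | rewrite -E; ring].
Qed.

(** The same sieve without signs; at r = 1 the first three factors are the denominator of
    [Sover_gf]. *)
Lemma qpoch_15 r : (0 < r)%N ->
  qpoch ('q ^+ r) ('q ^+ (6 * r)) * qpoch ('q ^+ (5 * r)) ('q ^+ (6 * r)) * f_ (6 * r)
  * f_ (2 * r) * f_ (3 * r) = f_ r * f_ (6 * r) ^+ 2.
Proof.
move=> r0; have r30 : (0 < 3 * r)%N by lia.
rewrite -(f_odd r0) (qpoch_split3P r0) -(f_odd r30) mulnA -[(2 * 3)%N]/6%N.
move: (qpoch ('q ^+ r) _) (qpoch ('q ^+ (3 * r)) _) (qpoch ('q ^+ (5 * r)) _).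
move: (f_ (2 * r)) (f_ (6 * r)) => a b A B C; ring.
Qed.

Lemma theta_15n r : (0 < r)%N ->
  theta true (3 * r) (2 * r) * f_ (2 * r) * f_ (3 * r) = f_ r * f_ (6 * r) ^+ 2.
Proof.
move=> r0; rewrite jacobi_triple_product; [|lia|lia].
rewrite expr1 !mulN1r !opprK -mulnDl -mulnBl mul1n mulnA -[(2 * 3)%N]/6%N -(qpoch_15 r0).
rewrite -[(3 + 2)%N]/5%N.
by congr (_ * _ * _ * _); rewrite mulrC.
Qed.

(** Here the residues are 2 and 4 modulo 6: the even ones without the class of 0. *)
Lemma theta_24 r : (0 < r)%N ->
  theta false (3 * r) r * f_ (2 * r) * f_ (12 * r) = f_ (4 * r) * f_ (6 * r) ^+ 2.
Proof.
move=> r0; have r20 : (0 < 2 * r)%N by lia.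
have r60 : (0 < 6 * r)%N by lia.
rewrite jacobi_triple_product; [|lia|lia].
have := f_neg r60; have := f_neg r20; rewrite (qpoch_split3 _ r20) !mulnA.
rewrite -[(2 * 3)%N]/6%N -[(3 * 2)%N]/6%N -[(2 * 6)%N]/12%N -[(2 * 2)%N]/4%N => <- <-.
rewrite expr0 !mul1r.
rewrite !mulNr -!exprD.
have -> : (2 * r + 2 * r = 4 * r)%N by lia.
have -> : (2 * r + 4 * r = 6 * r)%N by lia.
have -> : (3 * r + r = 4 * r)%N by lia.
have -> : (3 * r - r = 2 * r)%N by lia.
move: (qpoch (- 'q ^+ (2 * r)) _) (qpoch (- 'q ^+ (4 * r)) _) (qpoch (- 'q ^+ (6 * r)) _).
move: (f_ (2 * r)) (f_ (6 * r)) => a b A B C; ring.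
Qed.

(** Euler's pentagonal number theorem: the residues 2, 4 and 0 modulo 6 exhaust the even ones. *)
Lemma theta_24n r : (0 < r)%N -> theta true (3 * r) r = f_ (2 * r).
Proof.
move=> r0; have r20 : (0 < 2 * r)%N by lia.
rewrite jacobi_triple_product; [|lia|lia].
rewrite expr1 !mulN1r !opprK [RHS](qpoch_split3 _ r20) -!exprD.
have -> : (2 * r + 2 * r = 4 * r)%N by lia.
have -> : (2 * r + 2 * (2 * r) = 6 * r)%N by lia.
have -> : (3 * (2 * r) = 6 * r)%N by lia.
have -> : (3 * r + r = 4 * r)%N by lia.
have -> : (3 * r - r = 2 * r)%N by lia.
have -> : (2 * (3 * r) = 6 * r)%N by lia.
by rewrite /f_; congr (_ * _); rewrite mulrC.
Qed.

(** * 2-dissections of eta quotients *)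

(* The carrier is abstract because over [fps int] a failing comparison of two   *)
(* terms unfolds Cauchy products and infinite products.                         *)
Section EtaQuotients.
Variables (R : comUnitRingType) (q : R) (f g : nat -> R).
Variables (sub : nat -> {rmorphism R -> R}) (neg : {rmorphism R -> R}).

Hypothesis f_unit : forall r, (0 < r)%N -> f r \is a GRing.unit.
Hypothesis gE : forall r, g r = (f r)^-1.
Hypothesis sub_inj : forall k, (0 < k)%N -> injective (sub k).
Hypothesis sub_q : forall k, (0 < k)%N -> sub k q = q ^+ k.
Hypothesis sub_f : forall k r, (0 < k)%N -> (0 < r)%N -> sub k (f r) = f (k * r).
Hypothesis neg_q : neg q = - q.
Hypothesis neg_feven : forall r, (0 < r)%N -> neg (f (2 * r)) = f (2 * r).
Hypothesis neg_fodd : forall r, odd r ->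
  neg (f r) * f r * f (4 * r) = f (2 * r) ^+ 3.

Variable theta : bool -> nat -> nat -> R.
Hypothesis theta_dissection : forall c d, (0 < c)%N -> (d <= c)%N ->
  theta false c d
  = theta false (4 * c) (2 * d) + q ^+ (c - d) * theta false (4 * c) (4 * c - 2 * d).
Hypothesis theta_product :
  theta true 3 0 * theta false 3 2 = theta true 6 2 ^+ 2 + q * theta true 6 4 ^+ 2.
Hypothesis theta_phi : forall r, (0 < r)%N ->
  theta false r 0 * f r ^+ 2 * f (4 * r) ^+ 2 = f (2 * r) ^+ 5.
Hypothesis theta_phin : forall r, (0 < r)%N ->
  theta true r 0 * f (2 * r) = f r ^+ 2.
Hypothesis theta_psi : forall r, (0 < r)%N ->
  theta false r r * f (2 * r) = 2 * f (4 * r) ^+ 2.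
Hypothesis theta_15 : forall r, (0 < r)%N ->
  theta false (3 * r) (2 * r) * f r * f (4 * r) * f (6 * r)
  = f (2 * r) ^+ 2 * f (3 * r) * f (12 * r).
Hypothesis theta_15n : forall r, (0 < r)%N ->
  theta true (3 * r) (2 * r) * f (2 * r) * f (3 * r) = f r * f (6 * r) ^+ 2.
Hypothesis theta_24 : forall r, (0 < r)%N ->
  theta false (3 * r) r * f (2 * r) * f (12 * r) = f (4 * r) * f (6 * r) ^+ 2.
Hypothesis theta_24n : forall r, (0 < r)%N -> theta true (3 * r) r = f (2 * r).

Let fg r : (0 < r)%N -> f r * g r = 1.
Proof. by move=> r0; rewrite gE divrr // f_unit. Qed.

Let fg1 := @fg 1 isT.
Let fg2 := @fg 2 isT.
Let fg3 := @fg 3 isT.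
Let fg4 := @fg 4 isT.
Let fg6 := @fg 6 isT.
Let fg8 := @fg 8 isT.
Let fg12 := @fg 12 isT.
Let fg16 := @fg 16 isT.
Let fg24 := @fg 24 isT.
Let fg48 := @fg 48 isT.

(** With [g r] standing for 1 / f_r, equalities of eta quotients become polynomial identities modulo
    f_r g_r = 1. *)
Ltac eta := ring: fg1 fg2 fg3 fg4 fg6 fg8 fg12 fg16 fg24 fg48.

Let sub_g k r : (0 < k)%N -> (0 < r)%N -> sub k (g r) = g (k * r).
Proof. by move=> k0 r0; rewrite !gE rmorphV ?f_unit // sub_f. Qed.

Let neg_geven r : (0 < r)%N -> neg (g (2 * r)) = g (2 * r).
Proof.
by move=> r0; rewrite !gE rmorphV ?neg_feven // f_unit // muln_gt0.
Qed.

Let neg_f r : odd r -> neg (f r) = f (2 * r) ^+ 3 * g r * g (4 * r).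
Proof.
move=> or; have r0 : (0 < r)%N by case: r or.
have r40 : (0 < 4 * r)%N by rewrite muln_gt0.
by rewrite -(neg_fodd or); ring: (fg r0) (fg r40).
Qed.

Let neg_g r : odd r -> neg (g r) = g (2 * r) ^+ 3 * f r * f (4 * r).
Proof.
move=> or; have r0 : (0 < r)%N by case: r or.
have r20 : (0 < 2 * r)%N by rewrite muln_gt0.
have r40 : (0 < 4 * r)%N by rewrite muln_gt0.
have := fg r0 => /(congr1 neg); rewrite rmorphM rmorph1 (neg_f or) => E.
rewrite -[LHS]mulr1 -[1](expr1n _ 3) -(fg r20).
transitivity (f (2 * r)%N ^+ 3 * g r * g (4 * r)%N * neg (g r)
  * (g (2 * r)%N ^+ 3 * f r * f (4 * r)%N)); last by rewrite E mul1r.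
by ring: (fg r0) (fg r40).
Qed.

Let sub2E :=
  (sub_q (isT : (0 < 2)%N),
   (@sub_f 2 1 isT isT : _ = f 2, @sub_f 2 2 isT isT : _ = f 4,
    @sub_f 2 3 isT isT : _ = f 6, @sub_f 2 4 isT isT : _ = f 8,
    @sub_f 2 6 isT isT : _ = f 12, @sub_f 2 8 isT isT : _ = f 16,
    @sub_f 2 12 isT isT : _ = f 24, @sub_f 2 24 isT isT : _ = f 48),
   (@sub_g 2 1 isT isT : _ = g 2, @sub_g 2 2 isT isT : _ = g 4,
    @sub_g 2 3 isT isT : _ = g 6, @sub_g 2 4 isT isT : _ = g 8,
    @sub_g 2 6 isT isT : _ = g 12, @sub_g 2 8 isT isT : _ = g 16,
    @sub_g 2 12 isT isT : _ = g 24, @sub_g 2 24 isT isT : _ = g 48)).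

Let sub3E :=
  (sub_q (isT : (0 < 3)%N),
   (@sub_f 3 2 isT isT : _ = f 6, @sub_f 3 4 isT isT : _ = f 12,
    @sub_f 3 8 isT isT : _ = f 24, @sub_f 3 16 isT isT : _ = f 48),
   (@sub_g 3 1 isT isT : _ = g 3, @sub_g 3 2 isT isT : _ = g 6,
    @sub_g 3 8 isT isT : _ = g 24, @sub_g 3 16 isT isT : _ = g 48)).

Let negE :=
  (neg_q,
   (@neg_f 1 isT : _ = f 2 ^+ 3 * g 1 * g 4, @neg_f 3 isT : _ = f 6 ^+ 3 * g 3 * g 12,
    @neg_g 1 isT : _ = g 2 ^+ 3 * f 1 * f 4, @neg_g 3 isT : _ = g 6 ^+ 3 * f 3 * f 12),
   (@neg_feven 1 isT : _ = f 2, @neg_feven 2 isT : _ = f 4, @neg_feven 3 isT : _ = f 6,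
    @neg_feven 4 isT : _ = f 8, @neg_feven 6 isT : _ = f 12, @neg_feven 8 isT : _ = f 16,
    @neg_feven 12 isT : _ = f 24, @neg_feven 24 isT : _ = f 48),
   (@neg_geven 1 isT : _ = g 2, @neg_geven 2 isT : _ = g 4, @neg_geven 3 isT : _ = g 6,
    @neg_geven 4 isT : _ = g 8, @neg_geven 6 isT : _ = g 12, @neg_geven 8 isT : _ = g 16,
    @neg_geven 12 isT : _ = g 24, @neg_geven 24 isT : _ = g 48)).

Let morphE (h : {rmorphism R -> R}) :=
  (rmorphD h, rmorphN h, rmorphM h, rmorphXn h, rmorph_nat h).

Lemma phi_dissection :
  f 2 ^+ 5 * g 1 ^+ 2 * g 4 ^+ 2
  = f 8 ^+ 5 * g 4 ^+ 2 * g 16 ^+ 2 + q * (2 * f 16 ^+ 2 * g 8).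
Proof.
have E1 : _ = f 2 ^+ 5 := @theta_phi 1 isT.
have E2 : _ = f 8 ^+ 5 := @theta_phi 4 isT.
have E3 : _ = 2 * f 16 ^+ 2 := @theta_psi 4 isT.
have D : _ = theta false 4 0 + q * theta false 4 4 := @theta_dissection 1 0 isT isT.
by rewrite -E1 -E2 -E3 D; eta.
Qed.

Let theta15E :
  theta false 3 2 = f 2 ^+ 2 * f 3 * f 12 * g 1 * g 4 * g 6.
Proof.
have E : _ = f 2 ^+ 2 * f 3 * f 12 := @theta_15 1 isT.
by rewrite -E; eta.
Qed.

Lemma theta15_dissection :
  f 2 ^+ 2 * f 3 * f 12 * g 1 * g 4 * g 6
  = f 16 * f 24 ^+ 2 * g 8 * g 48 + q * (f 8 ^+ 2 * f 12 * f 48 * g 4 * g 16 * g 24).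
Proof.
have E1 : _ = f 16 * f 24 ^+ 2 := @theta_24 4 isT.
have E2 : _ = f 8 ^+ 2 * f 12 * f 48 := @theta_15 4 isT.
have D : _ = theta false 12 4 + q * theta false 12 8 := @theta_dissection 3 2 isT isT.
by rewrite -E1 -E2 -theta15E D; eta.
Qed.

Lemma phi3_theta15 :
  f 3 ^+ 2 * g 6 * (f 2 ^+ 2 * f 3 * f 12 * g 1 * g 4 * g 6)
  = f 4 ^+ 2 + q * (f 2 * f 12 ^+ 2 * g 4 * g 6) ^+ 2.
Proof.
have E1 : _ = f 3 ^+ 2 := @theta_phin 3 isT.
have E2 : _ = f 4 := @theta_24n 2 isT.
have E3 : _ = f 2 * f 12 ^+ 2 := @theta_15n 2 isT.
transitivity (theta true 3 0 * theta false 3 2).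
  by rewrite -E1 -theta15E; eta.
by rewrite theta_product -E2 -E3; eta.
Qed.

(** The quotient is f(q, q^5) times an eta quotient in q^2. *)
Lemma f3_div_f1 :
  f 3 * g 1 = f 4 * f 6 * f 16 * f 24 ^+ 2 * g 2 ^+ 2 * g 8 * g 12 * g 48
              + q * (f 6 * f 8 ^+ 2 * f 48 * g 2 ^+ 2 * g 16 * g 24).
Proof.
transitivity (f 2 ^+ 2 * f 3 * f 12 * g 1 * g 4 * g 6
  * (f 4 * f 6 * g 2 ^+ 2 * g 12)); first by eta.
by rewrite theta15_dissection; eta.
Qed.

(** If f(q, q^5) = A + q B with A and B series in q^2, then its product with the series at - q is
    A^2 - q^2 B^2. Injectivity of [sub 2] allows q^2 to be replaced by q throughout, and f_1 f_3 is
    the resulting series times f_2 / f_6. *)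
Lemma f1f3_dissection :
  f 1 * f 3 = f 2 * f 8 ^+ 2 * f 12 ^+ 4 * g 4 ^+ 2 * g 6 * g 24 ^+ 2
              - q * (f 4 ^+ 4 * f 6 * f 24 ^+ 2 * g 2 * g 8 ^+ 2 * g 12 ^+ 2).
Proof.
have := congr1 neg theta15_dissection; rewrite !morphE !negE => Dneg.
have E : f 1 * f 3 * f 6 * g 2 = (f 8 * f 12 ^+ 2 * g 4 * g 24) ^+ 2
   - q * (f 4 ^+ 2 * f 6 * f 24 * g 2 * g 8 * g 12) ^+ 2.
  apply: (@sub_inj 2) => //; rewrite !morphE !sub2E.
  transitivity (f 2 ^+ 2 * f 3 * f 12 * g 1 * g 4 * g 6
    * (f 2 ^+ 2 * (f 6 ^+ 3 * g 3 * g 12) * f 12 * (g 2 ^+ 3 * f 1 * f 4) * g 4 * g 6)).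
    by eta.
  by rewrite Dneg theta15_dissection; eta.
transitivity (f 1 * f 3 * f 6 * g 2 * (f 2 * g 6)); first by eta.
by rewrite E; eta.
Qed.

(** Under q -> - q, f_1 f_3 becomes 1 / (f_1 f_3) times an eta quotient in q^2. *)
Lemma g1g3_dissection :
  g 1 * g 3 = f 8 ^+ 2 * f 12 ^+ 5 * g 2 ^+ 2 * g 4 * g 6 ^+ 4 * g 24 ^+ 2
              + q * (f 4 ^+ 5 * f 24 ^+ 2 * g 2 ^+ 4 * g 6 ^+ 2 * g 8 ^+ 2 * g 12).
Proof.
have := congr1 neg f1f3_dissection; rewrite !morphE !negE => E.
transitivity (f 2 ^+ 3 * g 1 * g 4 * (f 6 ^+ 3 * g 3 * g 12)
   * (f 4 * f 12 * g 2 ^+ 3 * g 6 ^+ 3)); first by eta.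
by rewrite E; eta.
Qed.

Lemma g1sqr_dissection :
  g 1 ^+ 2 = f 8 ^+ 5 * g 2 ^+ 5 * g 16 ^+ 2
             + q * (2 * f 4 ^+ 2 * f 16 ^+ 2 * g 2 ^+ 5 * g 8).
Proof.
transitivity (f 2 ^+ 5 * g 1 ^+ 2 * g 4 ^+ 2 * (f 4 ^+ 2 * g 2 ^+ 5)); first by eta.
by rewrite phi_dissection; eta.
Qed.

(** [E] dissects phi(- q)^2: it is phi(q) phi(- q) = phi(- q^2)^2 read with q^2 replaced by q. Then
    q -> - q gives phi(q)^2, which is 1 / f_1^4 up to an eta quotient in q^2. *)
Lemma g1X4_dissection :
  g 1 ^+ 4 = f 4 ^+ 14 * g 2 ^+ 14 * g 8 ^+ 4
             + q * (4 * f 4 ^+ 2 * f 8 ^+ 4 * g 2 ^+ 10).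
Proof.
have := congr1 neg phi_dissection; rewrite !morphE !negE => Dneg.
have E : f 1 ^+ 4 * g 2 ^+ 2 = f 4 ^+ 10 * g 2 ^+ 4 * g 8 ^+ 4
   - q * (4 * f 8 ^+ 4 * g 4 ^+ 2).
  apply: (@sub_inj 2) => //; rewrite !morphE !sub2E.
  transitivity (f 2 ^+ 5 * g 1 ^+ 2 * g 4 ^+ 2
    * (f 2 ^+ 5 * (g 2 ^+ 3 * f 1 * f 4) ^+ 2 * g 4 ^+ 2)); first by eta.
  by rewrite Dneg phi_dissection; eta.
have := congr1 neg E; rewrite !morphE !negE => Eneg.
transitivity ((f 2 ^+ 3 * g 1 * g 4) ^+ 4 * g 2 ^+ 2 * (f 4 ^+ 4 * g 2 ^+ 10)); first by eta.
by rewrite Eneg; eta.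
Qed.

Lemma f1_div_f3X3 :
  f 1 * g 3 ^+ 3 = f 2 * f 4 ^+ 2 * f 12 ^+ 2 * g 6 ^+ 7
                   - q * (f 2 ^+ 3 * f 12 ^+ 6 * g 4 ^+ 2 * g 6 ^+ 9).
Proof.
have := congr1 neg phi3_theta15; rewrite !morphE !negE => E.
transitivity ((f 6 ^+ 3 * g 3 * g 12) ^+ 2 * g 6
  * (f 2 ^+ 2 * (f 6 ^+ 3 * g 3 * g 12) * f 12 * (g 2 ^+ 3 * f 1 * f 4) * g 4 * g 6)
  * (f 2 * f 12 ^+ 2 * g 6 ^+ 7)); first by eta.
by rewrite E; eta.
Qed.

Lemma g3sqr_dissection :
  g 3 ^+ 2 = f 24 ^+ 5 * g 6 ^+ 5 * g 48 ^+ 2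
             + q ^+ 3 * (2 * f 12 ^+ 2 * f 48 ^+ 2 * g 6 ^+ 5 * g 24).
Proof. by have := congr1 (sub 3) g1sqr_dissection; rewrite !morphE !sub3E. Qed.

Lemma g3X4_dissection :
  g 3 ^+ 4 = f 12 ^+ 14 * g 6 ^+ 14 * g 24 ^+ 4
             + q ^+ 3 * (4 * f 12 ^+ 2 * f 24 ^+ 4 * g 6 ^+ 10).
Proof. by have := congr1 (sub 3) g1X4_dissection; rewrite !morphE !sub3E. Qed.

(** * The three rounds of dissection of the generating function *)

Ltac fractions :=
  rewrite ?invrM ?unitrM ?unitrX ?f_unit // -?exprVn -?gE.

Lemma Sover_dissection1 :
  f 2 * f 3 * g 1 * g 6 ^+ 2
  = sub 2 (f 2 * f 8 * f 12 ^+ 2 * g 1 * g 3 * g 4 * g 6 * g 24)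
    + q * sub 2 (f 4 ^+ 2 * f 24 * g 1 * g 3 * g 8 * g 12).
Proof.
rewrite !morphE !sub2E.
transitivity (f 3 * g 1 * (f 2 * g 6 ^+ 2)); first by ring.
by rewrite f3_div_f1; eta.
Qed.

(** In the names [Sover_dissection2_i] and [Sover_dissection3_i] the final digit is the class of the
    exponents modulo 2 and modulo 4, respectively. *)
Lemma Sover_dissection2_0 :
  f 2 * f 8 * f 12 ^+ 2 * g 1 * g 3 * g 4 * g 6 * g 24
  = sub 2 (f 4 ^+ 3 * f 6 ^+ 7 * g 1 * g 2 ^+ 2 * g 3 ^+ 5 * g 12 ^+ 3)
    + q * sub 2 (f 2 ^+ 4 * f 6 * f 12 * g 1 ^+ 3 * g 3 ^+ 3 * g 4).
Proof.
rewrite !morphE !sub2E.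
transitivity (g 1 * g 3 * (f 2 * f 8 * f 12 ^+ 2 * g 4 * g 6 * g 24)); first by ring.
by rewrite g1g3_dissection; eta.
Qed.

Lemma Sover_dissection2_1 :
  f 4 ^+ 2 * f 24 * g 1 * g 3 * g 8 * g 12
  = sub 2 (f 2 * f 4 * f 6 ^+ 4 * g 1 ^+ 2 * g 3 ^+ 4 * g 12)
    + q * sub 2 (f 2 ^+ 7 * f 12 ^+ 3 * g 1 ^+ 4 * g 3 ^+ 2 * g 4 ^+ 3 * g 6 ^+ 2).
Proof.
rewrite !morphE !sub2E.
transitivity (g 1 * g 3 * (f 4 ^+ 2 * f 24 * g 8 * g 12)); first by ring.
by rewrite g1g3_dissection; eta.
Qed.

(** A product (A + q B)(C + q^3 D) has even part A C + q^4 B D and odd part q (B C + q^2 A D), which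
    explains the factors q^2 and q after halving. *)
Lemma Sover_dissection3_0 :
  f 4 ^+ 3 * f 6 ^+ 7 * g 1 * g 2 ^+ 2 * g 3 ^+ 5 * g 12 ^+ 3
  = sub 2 (
     (f 2 ^+ 2 * f 4 ^+ 2 * f 6 ^+ 16)
       / (f 1 ^+ 4 * f 3 ^+ 11 * f 12 ^+ 6)
     + 4 * q ^+ 2 * ((f 2 ^+ 8 * f 12 ^+ 6)
       / (f 1 ^+ 6 * f 3 ^+ 5 * f 4 ^+ 2 * f 6 ^+ 2)))
    + q * sub 2 (
     (f 2 ^+ 8 * f 6 ^+ 10)
       / (f 1 ^+ 6 * f 3 ^+ 9 * f 4 ^+ 2 * f 12 ^+ 2)
     + 4 * q * ((f 2 ^+ 2 * f 4 ^+ 2 * f 6 ^+ 4 * f 12 ^+ 2)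
       / (f 1 ^+ 4 * f 3 ^+ 7))).
Proof.
fractions; rewrite !morphE !sub2E.
transitivity (g 1 * g 3 * g 3 ^+ 4 * (f 4 ^+ 3 * f 6 ^+ 7 * g 2 ^+ 2 * g 12 ^+ 3)).
  by eta.
by rewrite g3X4_dissection g1g3_dissection; eta.
Qed.

Lemma Sover_dissection3_1 :
  f 2 * f 4 * f 6 ^+ 4 * g 1 ^+ 2 * g 3 ^+ 4 * g 12
  = sub 2 (
     (f 2 * f 4 ^+ 5 * f 6 ^+ 13)
       / (f 1 ^+ 4 * f 3 ^+ 10 * f 8 ^+ 2 * f 12 ^+ 4)
     + 8 * q ^+ 2 * ((f 2 ^+ 3 * f 6 * f 8 ^+ 2 * f 12 ^+ 4)
       / (f 1 ^+ 4 * f 3 ^+ 6 * f 4)))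
    + q * sub 2 (
     2 * ((f 2 ^+ 3 * f 6 ^+ 13 * f 8 ^+ 2)
       / (f 1 ^+ 4 * f 3 ^+ 10 * f 4 * f 12 ^+ 4))
     + 4 * q * ((f 2 * f 4 ^+ 5 * f 6 * f 12 ^+ 4)
       / (f 1 ^+ 4 * f 3 ^+ 6 * f 8 ^+ 2))).
Proof.
fractions; rewrite !morphE !sub2E.
transitivity (g 1 ^+ 2 * g 3 ^+ 4 * (f 2 * f 4 * f 6 ^+ 4 * g 12)); first by eta.
by rewrite g1sqr_dissection g3X4_dissection; eta.
Qed.

(** Writing 1 / (f_1 f_3)^3 as 1 / f_1^4 times f_1 / f_3^3 makes it a product of two dissected
    factors. *)
Lemma Sover_dissection3_2 :
  f 2 ^+ 4 * f 6 * f 12 * g 1 ^+ 3 * g 3 ^+ 3 * g 4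
  = sub 2 (
     (f 2 ^+ 15 * f 6 ^+ 3)
       / (f 1 ^+ 9 * f 3 ^+ 6 * f 4 ^+ 4)
     - 4 * q * ((f 4 ^+ 4 * f 6 ^+ 7)
       / (f 1 ^+ 3 * f 2 * f 3 ^+ 8)))
    + q * sub 2 (
     4 * ((f 2 ^+ 3 * f 4 ^+ 4 * f 6 ^+ 3)
       / (f 1 ^+ 5 * f 3 ^+ 6))
     - (f 2 ^+ 11 * f 6 ^+ 7)
       / (f 1 ^+ 7 * f 3 ^+ 8 * f 4 ^+ 4)).
Proof.
fractions; rewrite !morphE !sub2E.
transitivity (g 1 ^+ 4 * (f 1 * g 3 ^+ 3) * (f 2 ^+ 4 * f 6 * f 12 * g 4)); first by eta.
by rewrite g1X4_dissection f1_div_f3X3; eta.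
Qed.

Lemma Sover_dissection3_3 :
  f 2 ^+ 7 * f 12 ^+ 3 * g 1 ^+ 4 * g 3 ^+ 2 * g 4 ^+ 3 * g 6 ^+ 2
  = sub 2 (
     (f 2 ^+ 11 * f 6 ^+ 3 * f 12 ^+ 5)
       / (f 1 ^+ 7 * f 3 ^+ 7 * f 4 ^+ 4 * f 24 ^+ 2)
     + 8 * q ^+ 2 * ((f 4 ^+ 4 * f 6 ^+ 5 * f 24 ^+ 2)
       / (f 1 ^+ 3 * f 2 * f 3 ^+ 7 * f 12)))
    + q * sub 2 (
     4 * ((f 4 ^+ 4 * f 6 ^+ 3 * f 12 ^+ 5)
       / (f 1 ^+ 3 * f 2 * f 3 ^+ 7 * f 24 ^+ 2))
     + 2 * q * ((f 2 ^+ 11 * f 6 ^+ 5 * f 24 ^+ 2)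
       / (f 1 ^+ 7 * f 3 ^+ 7 * f 4 ^+ 4 * f 12))).
Proof.
fractions; rewrite !morphE !sub2E.
transitivity (g 1 ^+ 4 * g 3 ^+ 2 * (f 2 ^+ 7 * f 12 ^+ 3 * g 4 ^+ 3 * g 6 ^+ 2)).
  by eta.
by rewrite g1X4_dissection g3sqr_dissection; eta.
Qed.

Lemma Sover_dissections :
  f 2 * f 3 * g 1 * g 6 ^+ 2 =
  sub 2
    (sub 2
       (sub 2 ((f 2 ^+ 2 * f 4 ^+ 2 * f 6 ^+ 16) / (f 1 ^+ 4 * f 3 ^+
                11 * f 12 ^+ 6) + 4 * q ^+ 2 * ((f 2 ^+ 8 * f 12 ^+ 6) /
                (f 1 ^+ 6 * f 3 ^+ 5 * f 4 ^+ 2 * f 6 ^+ 2)))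
        + q * sub 2 ((f 2 ^+ 8 * f 6 ^+ 10) / (f 1 ^+ 6 * f 3 ^+ 9 * f 4 ^+ 2
                * f 12 ^+ 2) + 4 * q * ((f 2 ^+ 2 * f 4 ^+ 2 * f 6 ^+ 4
                * f 12 ^+ 2) / (f 1 ^+ 4 * f 3 ^+ 7))))
     + q * sub 2
       (sub 2 ((f 2 ^+ 15 * f 6 ^+ 3) / (f 1 ^+ 9 * f 3 ^+ 6 * f 4 ^+
                4) - 4 * q * ((f 4 ^+ 4 * f 6 ^+ 7) / (f 1 ^+ 3 * f 2 *
                f 3 ^+ 8)))
        + q * sub 2 (4 * ((f 2 ^+ 3 * f 4 ^+ 4 * f 6 ^+ 3) / (f 1 ^+ 5 * f 3
                ^+ 6)) - (f 2 ^+ 11 * f 6 ^+ 7) / (f 1 ^+ 7 * f 3 ^+ 8 *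
                f 4 ^+ 4))))
  + q * sub 2
    (sub 2
       (sub 2 ((f 2 * f 4 ^+ 5 * f 6 ^+ 13) / (f 1 ^+ 4 * f 3 ^+ 10 * f
                8 ^+ 2 * f 12 ^+ 4) + 8 * q ^+ 2 * ((f 2 ^+ 3 * f 6 * f
                8 ^+ 2 * f 12 ^+ 4) / (f 1 ^+ 4 * f 3 ^+ 6 * f 4)))
        + q * sub 2 (2 * ((f 2 ^+ 3 * f 6 ^+ 13 * f 8 ^+ 2) / (f 1 ^+ 4 * f 3
                ^+ 10 * f 4 * f 12 ^+ 4)) + 4 * q * ((f 2 * f 4 ^+ 5 * f
                6 * f 12 ^+ 4) / (f 1 ^+ 4 * f 3 ^+ 6 * f 8 ^+ 2))))
     + q * sub 2
       (sub 2 ((f 2 ^+ 11 * f 6 ^+ 3 * f 12 ^+ 5) / (f 1 ^+ 7 * f 3 ^+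
                7 * f 4 ^+ 4 * f 24 ^+ 2) + 8 * q ^+ 2 * ((f 4 ^+ 4 * f
                6 ^+ 5 * f 24 ^+ 2) / (f 1 ^+ 3 * f 2 * f 3 ^+ 7 * f
                12)))
        + q * sub 2 (4 * ((f 4 ^+ 4 * f 6 ^+ 3 * f 12 ^+ 5) / (f 1 ^+ 3 * f 2
                * f 3 ^+ 7 * f 24 ^+ 2)) + 2 * q * ((f 2 ^+ 11 * f 6 ^+
                5 * f 24 ^+ 2) / (f 1 ^+ 7 * f 3 ^+ 7 * f 4 ^+ 4 * f
                12))))).
Proof.
rewrite -Sover_dissection3_0 -Sover_dissection3_1 -Sover_dissection3_2.
rewrite -Sover_dissection3_3 -Sover_dissection2_0 -Sover_dissection2_1.
exact: Sover_dissection1.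
Qed.

End EtaQuotients.

(** * Reading off the residue classes modulo 8 *)

(** The place of each series in the nest is given by the binary digits of its class, the outermost
    splitting reading the lowest digit. *)
Lemma dissection8 (a s0 s1 s2 s3 s4 s5 s6 s7 : fps int) :
  a = subps 2 (subps 2 (subps 2 s0 + 'q * subps 2 s4)
               + 'q * subps 2 (subps 2 s2 + 'q * subps 2 s6))
      + 'q * subps 2 (subps 2 (subps 2 s1 + 'q * subps 2 s5)
                      + 'q * subps 2 (subps 2 s3 + 'q * subps 2 s7)) ->
  FPS (fun n => coefps a (8 * n)) = s0 /\
  FPS (fun n => coefps a (8 * n + 1)) = s1 /\
  FPS (fun n => coefps a (8 * n + 2)) = s2 /\
  FPS (fun n => coefps a (8 * n + 3)) = s3 /\
  FPS (fun n => coefps a (8 * n + 4)) = s4 /\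
  FPS (fun n => coefps a (8 * n + 5)) = s5 /\
  FPS (fun n => coefps a (8 * n + 6)) = s6 /\
  FPS (fun n => coefps a (8 * n + 7)) = s7.
Proof.
move=> /dissection[a0 a1].
have [a00 a01] := dissection (erefl (subps 2 (subps 2 s0 + 'q * subps 2 s4)
               + 'q * subps 2 (subps 2 s2 + 'q * subps 2 s6))).
have [a10 a11] := dissection (erefl (subps 2 (subps 2 s1 + 'q * subps 2 s5)
               + 'q * subps 2 (subps 2 s3 + 'q * subps 2 s7))).
have [b0 b4] := dissection (erefl (subps 2 s0 + 'q * subps 2 s4)).
have [b1 b5] := dissection (erefl (subps 2 s1 + 'q * subps 2 s5)).
have [b2 b6] := dissection (erefl (subps 2 s2 + 'q * subps 2 s6)).
have [b3 b7] := dissection (erefl (subps 2 s3 + 'q * subps 2 s7)).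
split; [|split; [|split; [|split; [|split; [|split; [|split]]]]]]; apply/fpsP => n.
- by rewrite -b0 -a00 -a0; congr (coefps a _); lia.
- by rewrite -b1 -a10 -a1; congr (coefps a _); lia.
- by rewrite -b2 -a01 -a0; congr (coefps a _); lia.
- by rewrite -b3 -a11 -a1; congr (coefps a _); lia.
- by rewrite -b4 -a00 -a0; congr (coefps a _); lia.
- by rewrite -b5 -a10 -a1; congr (coefps a _); lia.
- by rewrite -b6 -a01 -a0; congr (coefps a _); lia.
- by rewrite -b7 -a11 -a1; congr (coefps a _); lia.
Qed.

(** By [qpoch_15] at r = 1 the denominator of [Sover_gf] is f_1 f_6^2 / (f_2 f_3). *)
Lemma Sover_gfE : Sover_gf = f_ 2 * f_ 3 * (f_ 1)^-1 * (f_ 6)^-1 ^+ 2.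
Proof.
have E := qpoch_15 (isT : (0 < 1)%N).
have {}E : qpoch 'q ('q ^+ 6) * qpoch ('q ^+ 5) ('q ^+ 6) * qpoch ('q ^+ 6) ('q ^+ 6)
  * f_ 2 * f_ 3 = f_ 1 * f_ 6 ^+ 2 := E.
have := f_unit (isT : (0 < 1)%N); have := f_unit (isT : (0 < 6)%N).
have := qpoch_unit 6 (isT : (0 < 1)%N); rewrite expr1.
have := qpoch_unit 6 (isT : (0 < 5)%N); have := qpoch_unit 6 (isT : (0 < 6)%N).
rewrite /Sover_gf; move: E.
move: (qpoch ('q ^+ 6) _) (qpoch ('q ^+ 5) _) (qpoch 'q _) => A B C.
move: f_ => f E uA uB uC u6 u1.
have uP : C * B * A \is a GRing.unit by rewrite !unitrM uA uB uC.
apply: (mulIr uP); rewrite mul1r mulVr //.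
transitivity (C * B * A * f 2 * f 3 * ((f 1)^-1 * (f 6)^-1 ^+ 2)); last by ring.
by rewrite E mulrACA divrr // mul1r -exprMn divrr // expr1n.
Qed.

Theorem theorem3p3 :
  (FPS (fun n => Sover (8 * n)) =
     (f_ 2 ^+ 2 * f_ 4 ^+ 2 * f_ 6 ^+ 16)
       / (f_ 1 ^+ 4 * f_ 3 ^+ 11 * f_ 12 ^+ 6)
     + 4 * 'q ^+ 2 * ((f_ 2 ^+ 8 * f_ 12 ^+ 6)
       / (f_ 1 ^+ 6 * f_ 3 ^+ 5 * f_ 4 ^+ 2 * f_ 6 ^+ 2)))
  /\
  (FPS (fun n => Sover (8 * n + 1)) =
     (f_ 2 * f_ 4 ^+ 5 * f_ 6 ^+ 13)
       / (f_ 1 ^+ 4 * f_ 3 ^+ 10 * f_ 8 ^+ 2 * f_ 12 ^+ 4)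
     + 8 * 'q ^+ 2 * ((f_ 2 ^+ 3 * f_ 6 * f_ 8 ^+ 2 * f_ 12 ^+ 4)
       / (f_ 1 ^+ 4 * f_ 3 ^+ 6 * f_ 4)))
  /\
  (FPS (fun n => Sover (8 * n + 2)) =
     (f_ 2 ^+ 15 * f_ 6 ^+ 3)
       / (f_ 1 ^+ 9 * f_ 3 ^+ 6 * f_ 4 ^+ 4)
     - 4 * 'q * ((f_ 4 ^+ 4 * f_ 6 ^+ 7)
       / (f_ 1 ^+ 3 * f_ 2 * f_ 3 ^+ 8)))
  /\
  (FPS (fun n => Sover (8 * n + 3)) =
     (f_ 2 ^+ 11 * f_ 6 ^+ 3 * f_ 12 ^+ 5)
       / (f_ 1 ^+ 7 * f_ 3 ^+ 7 * f_ 4 ^+ 4 * f_ 24 ^+ 2)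
     + 8 * 'q ^+ 2 * ((f_ 4 ^+ 4 * f_ 6 ^+ 5 * f_ 24 ^+ 2)
       / (f_ 1 ^+ 3 * f_ 2 * f_ 3 ^+ 7 * f_ 12)))
  /\
  (FPS (fun n => Sover (8 * n + 4)) =
     (f_ 2 ^+ 8 * f_ 6 ^+ 10)
       / (f_ 1 ^+ 6 * f_ 3 ^+ 9 * f_ 4 ^+ 2 * f_ 12 ^+ 2)
     + 4 * 'q * ((f_ 2 ^+ 2 * f_ 4 ^+ 2 * f_ 6 ^+ 4 * f_ 12 ^+ 2)
       / (f_ 1 ^+ 4 * f_ 3 ^+ 7)))
  /\
  (FPS (fun n => Sover (8 * n + 5)) =
     2 * ((f_ 2 ^+ 3 * f_ 6 ^+ 13 * f_ 8 ^+ 2)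
       / (f_ 1 ^+ 4 * f_ 3 ^+ 10 * f_ 4 * f_ 12 ^+ 4))
     + 4 * 'q * ((f_ 2 * f_ 4 ^+ 5 * f_ 6 * f_ 12 ^+ 4)
       / (f_ 1 ^+ 4 * f_ 3 ^+ 6 * f_ 8 ^+ 2)))
  /\
  (FPS (fun n => Sover (8 * n + 6)) =
     4 * ((f_ 2 ^+ 3 * f_ 4 ^+ 4 * f_ 6 ^+ 3)
       / (f_ 1 ^+ 5 * f_ 3 ^+ 6))
     - (f_ 2 ^+ 11 * f_ 6 ^+ 7)
       / (f_ 1 ^+ 7 * f_ 3 ^+ 8 * f_ 4 ^+ 4))
  /\
  (FPS (fun n => Sover (8 * n + 7)) =
     4 * ((f_ 4 ^+ 4 * f_ 6 ^+ 3 * f_ 12 ^+ 5)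
       / (f_ 1 ^+ 3 * f_ 2 * f_ 3 ^+ 7 * f_ 24 ^+ 2))
     + 2 * 'q * ((f_ 2 ^+ 11 * f_ 6 ^+ 5 * f_ 24 ^+ 2)
       / (f_ 1 ^+ 7 * f_ 3 ^+ 7 * f_ 4 ^+ 4 * f_ 12))).
Proof.
apply: dissection8; rewrite Sover_gfE.
exact: (@Sover_dissections (fps int) 'q f_ (fun r => (f_ r)^-1) subps negps f_unit
  (fun=> erefl) subps_inj subpsq subps_f negpsq negps_feven negps_fodd theta
  theta_dissection theta_product theta_phi theta_phin theta_psi theta_15 theta_15n
  theta_24 theta_24n).
Qed.
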